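(* Let $f:[0,1]\times\mathbb{R}\to\mathbb{R}$ satisfy: (C(c)) $f$ is continuous on $[0,1]\times\mathbb{R}$ and has a continuous partial derivative $f_x$ with respect to the second variable on $[0,1]\times\mathbb{R}$; (C(f)) there exist positive constants $A,B$ with $A<\pi^2$ such that $|f(t,x)|\leqslant A|x|+B$ for all $t\in[0,1]$, $x\in\mathbb{R}$; (C($f_x$)) $\inf_{(t,x)\in[0,1]\times\mathbb{R}} f_x(t,x)>-\pi^2$. Then the operator $T:\mathbb{X}\to L^2(0,1)$, $(Tx)(t)=\ddot{x}(t)-f(t,x(t))$ (a.e. $t\in[0,1]$), is a diffeomorphism, i.e. a $C^1$ bijection whose inverse is also $C^1$.
   Context: $\mathbb{X}=H^2(0,1)\cap H^1_0(0,1)$, where $H^1_0(0,1)$ consists of absolutely continuous $x$ on $[0,1]$ with $x(0)=x(1)=0$ and $\dot x\in L^2$, and $H^2(0,1)$ of those $x\in H^1(0,1)$ with $\dot x\in H^1(0,1)$. $\mathbb{X}$ is equipped with the norm $\|x\|_{\mathbb{X}}=\|\ddot{x}\|_{L^2}$. *)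

(* Defs.v *)
From HB Require Import structures.
From mathcomp Require Import all_boot all_order all_algebra.
From mathcomp Require Import all_classical all_reals all_analysis.
From Stdlib Require Import ClassicalEpsilon.
Set Implicit Arguments. Unset Strict Implicit. Unset Printing Implicit Defensive.
Import Order.TTheory GRing.Theory Num.Theory.
Import numFieldNormedType.Exports.
Local Open Scope classical_set_scope.
Local Open Scope ring_scope.

Section Defs.
Variable R : realType.
Local Notation mu := (@lebesgue_measure R).
Local Notation I01 := (`[0%R, 1%R]%classic : set R).

Definition fadd (u v : R -> R) : R -> R := fun t => u t + v t.
Definition fsub (u v : R -> R) : R -> R := fun t => u t - v t.
Definition fscale (a : R) (u : R -> R) : R -> R := fun t => a * u t.

Definition L2 (g : R -> R) : Prop :=
  measurable_fun I01 g /\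
  (\int[mu]_(t in I01) ((g t) ^+ 2)%:E < +oo)%E.

Definition L2norm (g : R -> R) : R :=
  Num.sqrt (fine (\int[mu]_(t in I01) ((g t) ^+ 2)%:E)%E).

Definition AC01 (x : R -> R) : Prop :=
  forall eps : R, 0 < eps -> exists2 delta : R, 0 < delta &
    forall (n : nat) (a b : nat -> R),
      (forall i, (i < n)%N -> 0 <= a i /\ a i <= b i /\ b i <= 1) ->
      (forall i j, (i < n)%N -> (j < n)%N -> i <> j -> b i <= a j \/ b j <= a i) ->
      \sum_(i < n) (b i - a i) < delta ->
      \sum_(i < n) `|x (b i) - x (a i)| < eps.

Definition H1_with_deriv (x v : R -> R) : Prop :=
  AC01 x /\ L2 v /\
  {ae mu, forall t : R, `]0%R, 1%R[%classic t -> is_derive t 1 x (v t)}.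

(* X = H^2(0,1) ∩ H^1_0(0,1): x is AC with x(0)=x(1)=0 and its
   derivative has an AC representative v whose derivative w is in L^2 *)
Definition inX (x : R -> R) : Prop :=
  exists v w, H1_with_deriv x v /\ H1_with_deriv v w /\ x 0 = 0 /\ x 1 = 0.

Definition ddot (x : R -> R) : R -> R :=
  epsilon (inhabits (fun _ => 0))
    (fun w => exists v, H1_with_deriv x v /\ H1_with_deriv v w).

Definition Xnorm (x : R -> R) : R := L2norm (ddot x).

(* ---- C^1 maps between (semi)normed function spaces ----
   A space is given by a carrier predicate P and a seminorm N; elements at
   N-distance 0 are identified (e.g. a.e.-equal functions in L^2). *)
Definition bounded_linear (PX : (R -> R) -> Prop) (NX : (R -> R) -> R)
    (PY : (R -> R) -> Prop) (NY : (R -> R) -> R)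
    (L : (R -> R) -> (R -> R)) : Prop :=
  (forall u, PX u -> PY (L u)) /\
  (forall u v, PX u -> PX v -> NY (fsub (L (fadd u v)) (fadd (L u) (L v))) = 0) /\
  (forall a u, PX u -> NY (fsub (L (fscale a u)) (fscale a (L u))) = 0) /\
  (exists C : R, forall u, PX u -> NY (L u) <= C * NX u).

Definition frechet_deriv (PX : (R -> R) -> Prop) (NX : (R -> R) -> R)
    (PY : (R -> R) -> Prop) (NY : (R -> R) -> R)
    (F : (R -> R) -> (R -> R)) (x : R -> R) (L : (R -> R) -> (R -> R)) : Prop :=
  bounded_linear PX NX PY NY L /\
  forall eps : R, 0 < eps -> exists2 delta : R, 0 < delta &
    forall h, PX h -> NX h < delta ->
      NY (fsub (fsub (F (fadd x h)) (F x)) (L h)) <= eps * NX h.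

Definition C1map (PX : (R -> R) -> Prop) (NX : (R -> R) -> R)
    (PY : (R -> R) -> Prop) (NY : (R -> R) -> R)
    (F : (R -> R) -> (R -> R)) : Prop :=
  (forall x, PX x -> PY (F x)) /\
  exists DF : (R -> R) -> (R -> R) -> (R -> R),
    (forall x, PX x -> frechet_deriv PX NX PY NY F x (DF x)) /\
    (forall x, PX x -> forall eps : R, 0 < eps -> exists2 delta : R, 0 < delta &
       forall y, PX y -> NX (fsub y x) < delta ->
         forall h, PX h -> NY (fsub (DF y h) (DF x h)) <= eps * NX h).

Definition diffeomorphism (PX : (R -> R) -> Prop) (NX : (R -> R) -> R)
    (PY : (R -> R) -> Prop) (NY : (R -> R) -> R)
    (F : (R -> R) -> (R -> R)) : Prop :=
  C1map PX NX PY NY F /\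
  exists G : (R -> R) -> (R -> R),
    C1map PY NY PX NX G /\
    (forall x, PX x -> NX (fsub (G (F x)) x) = 0) /\
    (forall y, PY y -> NY (fsub (F (G y)) y) = 0).

Definition Top (f : R -> R -> R) (x : R -> R) : R -> R :=
  fun t => ddot x t - f t (x t).

End Defs.

(* Main.v *)
(** Write [x'' = w] with [x(0) = x(1) = 0] as [D2 x w].  Since an absolutely
    continuous function with zero derivative almost everywhere is constant, [w]
    determines [x] and all the usual integrations by parts hold.  Picone's identity
    with [p = - l tan (l (t - 1/2))], a solution of [p' + p^2 = - l^2] that is regular
    on [[0, 1]] for [l < pi], gives [l^2 |x|^2 <= - int x x''].  Hence if
    [x'' = k + r] with [r x >= - c x^2] and [c < pi^2], then [sup |x| <= C |k|]
    with [C] depending on [c] only.  Applied to differences, this one estimate gives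
    injectivity, Lipschitz continuity of the inverse and bounded invertibility of the
    derivative; applied to [r = f(t, x) - f(t, 0)] it is an a priori bound, which
    lets one truncate [f] to a globally Lipschitz [g].  Then [x'' = y + tau g(x)] is
    solved by continuation from [tau = 0] to [tau = 1] with a step on which the
    same estimate makes the Picard iteration contract in the sup norm. *)

(* Only a lower bound on [f_x] is available, so even after truncation the Lipschitz constant [L] of
   the nonlinearity may be large. A single Picard iteration started from the linear problem would
   need [C * L < 1], which can fail. Small continuation steps avoid this, because the monotone part
   of the equation is kept implicit and [C] does not grow along the path. The room between [c] and
   [pi ^+ 2] is essential: at [l = pi] the tangent blows up at both endpoints, so the Riccati
   solution exists only for [l < pi], and the gap [l ^+ 2 - c > 0] appears in the denominators of
   [C]. Estimates are made in the sup norm because [f] and [f_x] are controlled on bounded sets of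
   values only; the equation itself then turns a sup bound into a bound on the second derivative.
   [ddot] picks one representative of a class of functions equal almost everywhere. Identities for
   the operator, its inverse and the derivatives therefore hold up to seminorm zero. The inverse is
   built globally as a solution operator, and its regularity is read off from estimates rather than
   from an inverse function theorem. *)
Require Import Defs.
From HB Require Import structures.
From mathcomp Require Import all_boot all_order all_algebra.
From mathcomp Require Import all_classical all_reals all_analysis.
From mathcomp Require Import measurable_realfun ring lra.
Import Order.TTheory GRing.Theory Num.Theory.
Import numFieldNormedType.Exports.
Local Open Scope classical_set_scope.
Local Open Scope ring_scope.
Set Implicit Arguments. Unset Strict Implicit. Unset Printing Implicit Defensive.

(** * Absolutely continuous functions with zero derivative *)

(** Real induction at the supremum of the points satisfying [P]. The step goes from a point at or
    left of [t] to a point at or right of [t], so one hypothesis serves both to reach the supremum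
    and to pass beyond it. *)
Lemma interval_induction (R : realType) (P : R -> Prop) (T : R) : 0 <= T -> P 0 ->
  (forall t, 0 <= t <= T -> exists2 eta, 0 < eta & forall s s',
     t - eta < s <= t -> t <= s' < t + eta -> 0 <= s -> s' <= T -> P s -> P s') ->
  P T.
Proof.
move=> T0 P0 step.
pose A := [set s | 0 <= s <= T /\ P s].
have A0 : A 0 by split => //; rewrite lexx.
have ubA : ubound A T by move=> s [/andP[]].
have hub : has_ubound A by exists T.
have supA : has_sup A by split; [exists 0|exists T].
pose t := sup A.
have t0 : 0 <= t by exact: ub_le_sup hub _ A0.
have tT : t <= T by apply: ge_sup ubA; exists 0.
have tb : 0 <= t <= T by rewrite t0 tT.
have [eta eta0 st] := step t tb.
have [s [/andP[s0 sT] Ps] ts] := sup_adherent eta0 supA.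
have sst : s <= t by apply: ub_le_sup hub _ _; split; rewrite ?s0.
have Hs : t - eta < s <= t by rewrite ts sst.
have [tT'|Tt] := ltP t T.
  pose s' := Num.min T (t + eta / 2).
  have ts' : t < s' by rewrite lt_min tT' ltrDl divr_gt0.
  have Ps' : P s'.
    apply: (st s s') => //; rewrite ?ge_min ?lexx//.
    rewrite (ltW ts') /= gt_min; apply/orP; right; lra.
  suff : s' <= t by rewrite leNgt ts'.
  apply: ub_le_sup hub _ _.
  split => //; apply/andP; split; first by lra.
  by rewrite ge_min lexx.
have tE : t = T by apply/eqP; rewrite eq_le tT Tt.
by rewrite -tE; apply: (st s t) => //; rewrite ?lexx //= ltrDl.
Qed.

Lemma is_derive0_bound (R : realType) (g : R -> R) (t e : R) : 0 < e ->
  is_derive t 1 g 0 ->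
  exists2 eta, 0 < eta & forall s, `|s - t| < eta -> `|g s - g t| <= e * `|s - t|.
Proof.
move=> e0 [dg D0].
have : h^-1 *: (g (h *: 1 + t) - g t) @[h --> 0^'] --> ('D_1 g t : R).
  exact: dg.
rewrite D0 => /cvgrPdist_le /(_ e e0)[eta /= eta0 H].
exists eta => // s st; have [->|nst] := eqVneq s t.
  by rewrite !subrr normr0 mulr0.
have := H (s - t); rewrite /ball /= sub0r normrN => /(_ st).
rewrite subr_eq0 => /(_ nst).
rewrite sub0r normrN normrZ normfV /= [(s - t) *: _]mulr1 subrK.
by rewrite mulrC ler_pdivrMr // normr_gt0 subr_eq0.
Qed.

(* Cover the exceptional null set by an open set of measure below the [delta] of
   absolute continuity.  Around every point, either [g] increases by at most
   [e * length] or the interval lies in the cover; [good s] says that [[0, s]] is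
   exhausted by finitely many intervals of these two kinds. *)
Lemma AC01_deriv0_cst (R : realType) (g : R -> R) : AC01 g ->
  {ae @lebesgue_measure R, forall t : R, `]0%R, 1%R[%classic t -> is_derive t 1 g 0} ->
  forall t, 0 <= t <= 1 -> g t = g 0.
Proof.
move=> ACg [N [mN N0 subN]] T /andP[T0 T1].
suff H e : 0 < e -> `|g T - g 0| <= 2 * e.
  apply/eqP; rewrite -subr_eq0 -normr_le0; apply/ler_addgt0Pr => e e0.
  by rewrite add0r (le_trans (H (e / 2) _)) ?divr_gt0// mulrCA divff ?mulr1.
move=> e0; have [d d0 Hd] := ACg e e0.
(* The derivative is known on the open interval only, so the endpoints join the exceptional set. *)
pose E := N `|` [set 0] `|` [set 1].
have mE : measurable E by do !apply: measurableU => //; exact: measurable_set1.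
have E0 : (@lebesgue_measure R) E = 0%E.
  have m1 (a : R) : measurable [set a] by exact: measurable_set1.
  have s1 (a : R) : (@lebesgue_measure R) [set a] = 0%E by exact: lebesgue_measure_set1.
  have mN0 : measurable (N `|` [set 0]) by exact: measurableU.
  by rewrite (measureU0 mN0 (m1 1) (s1 1)) (measureU0 mN (m1 0) (s1 0)).
have Elt : (@lebesgue_measure R E < +oo)%E by rewrite E0 ltry.
have [U [oU EU Ud]] := lebesgue_regularity_outer mE Elt d0.
have mU : measurable U by exact: open_measurable.
have : (@lebesgue_measure R U < d%:E)%E.
  have -> : U = E `|` (U `\` E) by rewrite setDUK.
  rewrite (@le_lt_trans _ _ (lebesgue_measure E + lebesgue_measure (U `\` E))%E)//.
    by apply: measureU2 => //; exact: measurableD.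
  by rewrite E0 add0e.
move=> {}Ud.
(* [m s] is the length of the part of the cover inside [[0, s]]. It is the budget for the total
   length of the intervals on which the derivative gives no control. *)
pose m s := fine (@lebesgue_measure R (U `&` (`[0%R, s]%classic : set R))).
have Ufin (s : R) : (@lebesgue_measure R (U `&` (`[0%R, s]%classic : set R)) < d%:E)%E.
  by apply: le_lt_trans Ud; apply: le_measure; rewrite ?inE//; exact: measurableI.
have Umeas (s : R) : measurable (U `&` (`[0%R, s]%classic : set R)) by exact: measurableI.
have mE' (s : R) : (m s)%:E = lebesgue_measure (U `&` (`[0%R, s]%classic : set R)).
  by rewrite fineK// ge0_fin_numE // (lt_trans (Ufin s)) ?ltry.
have mmono s s' : s <= s' -> m s <= m s'.
  move=> ss'; rewrite -lee_fin !mE'; apply: le_measure; rewrite ?inE; [exact: Umeas|exact: Umeas|].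
  move=> z [Uz]; rewrite /= in_itv /= => /andP[z0 zs]; split => //=.
  by rewrite in_itv /= z0 (le_trans zs).
have mstep s s' : 0 <= s -> s <= s' -> `[s, s'] `<=` U -> m s + (s' - s) <= m s'.
  move=> s0 ss' sU; rewrite -lee_fin EFinD !mE'.
  have -> : (s' - s)%:E = lebesgue_measure (`]s, s']%classic : set R).
    rewrite lebesgue_measure_itv /= lte_fin.
    by case: ltgtP ss' => // ->; rewrite subrr.
  have disj : (U `&` (`[0%R, s]%classic : set R)) `&` `]s, s'] = set0.
    apply/seteqP; split => // z [[_]]; rewrite /= !in_itv/= => /andP[_ zs] /andP[sz _].
    by move: (le_lt_trans zs sz); rewrite ltxx.
  have <- : lebesgue_measure ((U `&` (`[0%R, s]%classic : set R)) `|` `]s, s']%classic) =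
      (lebesgue_measure (U `&` (`[0%R, s]%classic : set R)) + lebesgue_measure (`]s, s']%classic : set R))%E.
    by rewrite measureU//; exact: Umeas.
  apply: le_measure; rewrite ?inE; [|exact: Umeas|].
    by apply: measurableU; [exact: Umeas|exact: measurable_itv].
  move=> z [[Uz]|]; rewrite /= in_itv /= => /andP[z0 zs]; (split; last rewrite /= in_itv /=).
  - exact: Uz.
  - by rewrite z0 (le_trans zs).
  - by apply: sU; rewrite /= in_itv /= zs ltW.
  - by rewrite zs (ltW (le_lt_trans s0 z0)).
(* The length is bounded by [m s] and not by [d]: by [mstep] this bound is preserved when one more
   interval of the cover is appended. *)
pose good s := exists (n : nat) (a b : nat -> R),
   [/\ (forall i, (i < n)%N -> 0 <= a i /\ a i <= b i /\ b i <= s),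
      (forall i j, (i < n)%N -> (j < n)%N -> i <> j -> b i <= a j \/ b j <= a i),
      \sum_(i < n) (b i - a i) <= m s &
      `|g s - g 0| <= e * s + \sum_(i < n) `|g (b i) - g (a i)|].
suff : good T.
  move=> [n [a [b [ab disj len gT]]]].
  have {}len : \sum_(i < n) (b i - a i) < d.
    by rewrite (le_lt_trans len)// -lte_fin mE'.
  have := Hd n a b; move/(_ _ disj len) => lee.
  apply: (le_trans gT); rewrite mulr_natl mulr2n lerD//.
    by rewrite ler_piMr// ltW.
  apply: ltW; apply: lee => i /ab [a0 [aib bT]]; split => //; split => //; exact: le_trans T1.
apply: interval_induction => //.
  exists 0%N, (fun=> 0), (fun=> 0); split => //.
    by rewrite big_ord0 /m fine_ge0.
  by rewrite big_ord0 subrr normr0 mulr0 addr0.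
move=> t /andP[t0 tT].
have [tE|tNE] := pselect (E t).
  have [eta /= eta0 He] : nbhs t U by exact: open_nbhs_nbhs (conj oU (EU _ tE)).
  exists eta => // s s' /andP[ts st] /andP[ts' s't] s0 s'T [n [a [b [ab disj len gs]]]].
  have ss' : s <= s' by exact: le_trans ts'.
  exists n.+1, (fun i => if i == n then s else a i), (fun i => if i == n then s' else b i).
  split.
  - move=> i; rewrite ltnS leq_eqVlt; case: eqVneq => [->|_] //=.
    by move=> /ab [? [? ?]]; split => //; split => //; exact: le_trans ss'.
  - move=> i j; rewrite !ltnS (leq_eqVlt i) (leq_eqVlt j); case: eqVneq => [->|_] /=; case: eqVneq => [->|_] //=.
    + by move=> _ /ab[? [? ?]]; right.
    + by move=> /ab[? [? ?]] _; left.
    + exact: disj.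
  - rewrite big_ord_recr /= eqxx.
    apply: le_trans (mstep _ _ s0 ss' _); last first.
      move=> z /=; rewrite in_itv/= => /andP[sz zs']; apply: He => /=.
      by rewrite /ball /= ltr_norml; apply/andP; split; lra.
    rewrite lerD2r; apply: le_trans len; rewrite le_eqVlt; apply/orP; left; apply/eqP.
    by apply: eq_bigr => i _; rewrite !ltn_eqF.
  - rewrite big_ord_recr /= eqxx.
    under eq_bigr => i _ do rewrite !ltn_eqF//.
    have : `|g s' - g 0| <= `|g s' - g s| + `|g s - g 0|.
      by rewrite (le_trans _ (ler_normD _ _))// addrA subrK.
    have : e * s <= e * s' by rewrite ler_pM2l.
    lra.
have tN : ~ N t by move=> Nt; apply: tNE; left; left.
have t01 : 0 < t < 1.
  rewrite !lt_neqAle t0 (le_trans tT T1) !andbT; apply/andP; split; apply/eqP => h; apply: tNE.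
    by left; right.
  by right.
have : is_derive t 1 g 0.
  by apply: contrapT => h; apply: tN; apply: subN => /=; apply: contra_not h; apply; rewrite in_itv.
move=> /(is_derive0_bound e0)[eta eta0 He].
exists eta => // s s' /andP[ts st] /andP[ts' s't] s0 s'T [n [a [b [ab disj len gs]]]].
have ss' : s <= s' by exact: le_trans ts'.
exists n, a, b; split => //.
- by move=> i /ab [? [? ?]]; split => //; split => //; exact: le_trans ss'.
- by apply: (le_trans len); exact: mmono.
- have h1 : `|g s - g t| <= e * (t - s).
    by rewrite -(ger0_norm (_ : 0 <= t - s)) ?subr_ge0// (distrC t s); apply: He; rewrite ltr_norml; lra.
  have h2 : `|g s' - g t| <= e * (s' - t).
    by rewrite -(ger0_norm (_ : 0 <= s' - t)) ?subr_ge0//; apply: He; rewrite ltr_norml; lra.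
  have : `|g s' - g 0| <= `|g s' - g t| + `|g s - g t| + `|g s - g 0|.
    rewrite (distrC (g s)) (le_trans _ (lerD (ler_normD _ _) (lexx _)))//.
    by rewrite (le_trans _ (ler_normD _ _))// !addrA !subrK.
  lra.
Qed.

(** * Square-integrable functions on the unit interval *)

Section L2_theory.
Variable R : realType.
Local Notation mu := (@lebesgue_measure R).
Local Notation I01 := (`[0%R, 1%R]%classic : set R).
Implicit Types (u v w x : R -> R).

Definition integ01 u := mu.-integrable I01 (EFin \o u).

Definition int01 u : R := \int[mu]_(t in I01) u t.

Definition ae01 u v := {ae mu, forall t : R, `]0%R, 1%R[%classic t -> u t = v t}.

Definition cont01 x := {within I01, continuous x}.

Let mI : measurable I01 := measurable_itv _.

Lemma in_I01 (t : R) : I01 t <-> 0 <= t <= 1.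
Proof. by rewrite /= in_itv. Qed.

Lemma mu_I01 : mu I01 = 1%:E.
Proof. by rewrite lebesgue_measure_itv /= lte_fin ltr01 oppr0 addr0. Qed.

Lemma integ01_le u v : measurable_fun I01 u -> (forall t, 0 <= t <= 1 -> `|u t| <= v t) ->
  integ01 v -> integ01 u.
Proof.
move=> mu_ uv; apply: le_integrable => //; first exact/measurable_EFinP.
by move=> t /in_I01 /uv h /=; rewrite lee_fin (le_trans h)// ler_norm.
Qed.

Lemma integ01_meas u : integ01 u -> measurable_fun I01 u.
Proof. by move=> /integrableP[/measurable_EFinP]. Qed.

Lemma L2_integ_sqr u : L2 u <-> measurable_fun I01 u /\ integ01 (fun t => u t ^+ 2).
Proof.
split=> -[mu_ iu]; split => //.
  apply/integrableP; split; first exact/measurable_EFinP/measurable_funX.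
  under eq_integral => t _ do rewrite /= ger0_norm ?sqr_ge0//.
  exact: iu.
move/integrableP : iu => [_]; apply: le_lt_trans.
rewrite le_eqVlt; apply/orP; left; apply/eqP.
by apply: eq_integral => t _; rewrite /= ger0_norm ?sqr_ge0.
Qed.

Lemma L2_meas u : L2 u -> measurable_fun I01 u. Proof. by case. Qed.

Lemma integ01D u v : integ01 u -> integ01 v -> integ01 (fun t => u t + v t).
Proof. by move=> iu iv; exact: (@integrableD _ _ R mu I01 mI _ _ iu iv). Qed.

Lemma integ01Z a u : integ01 u -> integ01 (fun t => a * u t).
Proof. by move=> iu; exact: (@integrableZl _ _ R mu I01 mI a _ iu). Qed.

Lemma L2_mul_integ u v : L2 u -> L2 v -> integ01 (fun t => u t * v t).
Proof.
move=> /L2_integ_sqr[mu_ iu] /L2_integ_sqr[mv iv].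
apply: integ01_le (integ01D iu iv); first exact: measurable_funM.
move=> t _; rewrite normrM -(real_normK (num_real (u t))) -(real_normK (num_real (v t))).
by have := sqr_ge0 (`|u t| - `|v t|); have := normr_ge0 (u t); have := normr_ge0 (v t); nra.
Qed.

Lemma bounded_L2 u M : measurable_fun I01 u -> (forall t, 0 <= t <= 1 -> `|u t| <= M) -> L2 u.
Proof.
move=> mu_ uM; apply/L2_integ_sqr; split => //.
apply: measurable_bounded_integrable => //; first by rewrite [X in (X < _)%E]mu_I01 ltry.
  exact: measurable_funX.
exists (M ^+ 2); split; first exact: num_real.
move=> x Mx t /in_I01 tI /=; apply: le_trans (ltW Mx).
rewrite normrX lerXn2r ?nnegrE ?uM//.
exact: le_trans (uM _ tI).
Qed.

Lemma L2_cst a : L2 (fun=> a : R).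
Proof. by apply: (@bounded_L2 _ `|a|) => //; exact: measurable_cst. Qed.

Lemma L2_integ u : L2 u -> integ01 u.
Proof.
move=> Lu; have := L2_mul_integ Lu (L2_cst 1).
by apply: eq_integrable => // t _ /=; rewrite mulr1.
Qed.

Lemma L2D u v : L2 u -> L2 v -> L2 (fadd u v).
Proof.
move=> Lu Lv; apply/L2_integ_sqr; split.
  by apply: measurable_funD; exact: L2_meas.
have [_ iu] := (L2_integ_sqr _).1 Lu; have [_ iv] := (L2_integ_sqr _).1 Lv.
have := integ01D (integ01D iu iv) (integ01Z 2 (L2_mul_integ Lu Lv)).
by apply: eq_integrable => // t _ /=; congr EFin; rewrite /fadd; ring.
Qed.

Lemma L2M_bounded u (b : R -> R) (M : R) : measurable_fun I01 b -> (forall t, 0 <= t <= 1 -> `|b t| <= M) ->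
  L2 u -> L2 (fun t => b t * u t).
Proof.
move=> mb bM /L2_integ_sqr[mu_ iu]; apply/L2_integ_sqr; split; first exact: measurable_funM.
apply: integ01_le (integ01Z (M ^+ 2) iu).
  by apply: measurable_funX; exact: measurable_funM.
move=> t tI; rewrite exprMn normrM (ger0_norm (sqr_ge0 (u t))) ler_wpM2r ?sqr_ge0//.
by rewrite normrX lerXn2r ?nnegrE ?bM//; exact: le_trans (bM _ tI).
Qed.

Lemma L2Z a u : L2 u -> L2 (fscale a u).
Proof. by apply: (@L2M_bounded _ _ `|a|) => //; exact: measurable_cst. Qed.

Lemma fsubE u v : fsub u v = fadd u (fscale (-1) v).
Proof. by apply/funext => t; rewrite /fsub /fadd /fscale mulN1r. Qed.

Lemma L2B u v : L2 u -> L2 v -> L2 (fsub u v).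
Proof. by move=> Lu Lv; rewrite fsubE; apply: L2D => //; exact: L2Z. Qed.

Lemma int01D u v : integ01 u -> integ01 v -> int01 (fun t => u t + v t) = int01 u + int01 v.
Proof. exact: RintegralD. Qed.

Lemma int01Z a u : integ01 u -> int01 (fun t => a * u t) = a * int01 u.
Proof. exact: RintegralZl. Qed.

Lemma int01_ge0 u : (forall t, 0 <= t <= 1 -> 0 <= u t) -> 0 <= int01 u.
Proof. by move=> u0; apply: Rintegral_ge0 => t /in_I01 /u0. Qed.

Lemma int01_le u v : integ01 u -> integ01 v -> (forall t, 0 <= t <= 1 -> u t <= v t) ->
  int01 u <= int01 v.
Proof. by move=> iu iv uv; apply: le_Rintegral => // t /in_I01 /uv. Qed.

Lemma int01_cst a : int01 (fun=> a) = a.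
Proof. by rewrite /int01 Rintegral_cst // [X in fine X]mu_I01 mulr1. Qed.

Lemma L2norm_sqr u : L2norm u ^+ 2 = int01 (fun t => u t ^+ 2).
Proof. by rewrite sqr_sqrtr //; apply: int01_ge0 => t _; exact: sqr_ge0. Qed.

Lemma L2norm_ge0 u : 0 <= L2norm u. Proof. exact: sqrtr_ge0. Qed.

Lemma int01_CauchySchwarz u v : L2 u -> L2 v ->
  `|int01 (fun t => u t * v t)| <= L2norm u * L2norm v.
Proof.
move=> Lu Lv.
have [_ iu] := (L2_integ_sqr _).1 Lu; have [_ iv] := (L2_integ_sqr _).1 Lv.
have iuv := L2_mul_integ Lu Lv.
(* The integral of [(a u + b v)^2] as a quadratic form in [a] and [b]. If [p = 0] it is affine in
   [a], which forces [c = 0]; otherwise [a = - c], [b = p^2] gives the discriminant inequality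
   multiplied by [p^2]. *)
have H (a b : R) : 0 <= a ^+ 2 * L2norm u ^+ 2 + 2 * a * b * int01 (fun t => u t * v t)
    + b ^+ 2 * L2norm v ^+ 2.
  rewrite !L2norm_sqr -!int01Z//.
  have iuv' := integ01Z (2 * a * b) iuv.
  have iu' := integ01Z (a ^+ 2) iu; have iv' := integ01Z (b ^+ 2) iv.
  rewrite -!int01D //; last exact: integ01D.
  apply: int01_ge0 => t _; have := sqr_ge0 (a * u t + b * v t); congr (0 <= _); ring.
have := L2norm_ge0 u; have := L2norm_ge0 v.
move: (L2norm u) (L2norm v) (int01 _) H => p q c H q0 p0.
suff : `|c| ^+ 2 <= (p * q) ^+ 2 by rewrite ler_sqr // nnegrE // mulr_ge0.
rewrite real_normK ?num_real//.
have [p00|pn0] := eqVneq p 0.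
  suff -> : c = 0 by rewrite expr0n /= sqr_ge0.
  apply/eqP/negPn/negP => c0.
  have := H (- (q ^+ 2 + 1) / c) 1; rewrite p00 expr0n mulr0 add0r !mulr1 expr1n mul1r.
  by rewrite -mulrA divfK//; have := sqr_ge0 q; lra.
have := H (- c) (p ^+ 2); rewrite [(p * q) ^+ 2]exprMn.
have : 0 < p ^+ 2 by rewrite exprn_gt0// lt_def pn0.
move: (p ^+ 2) (q ^+ 2) => P Q P0 h.
have : 0 <= P * (P * Q - c ^+ 2).
  by apply: le_trans h _; rewrite le_eqVlt; apply/orP; left; apply/eqP; ring.
by rewrite pmulr_rge0// subr_ge0.
Qed.

Lemma L2normD u v : L2 u -> L2 v -> L2norm (fadd u v) <= L2norm u + L2norm v.
Proof.
move=> Lu Lv; rewrite -ler_sqr ?nnegrE ?L2norm_ge0 ?addr_ge0 ?L2norm_ge0//.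
have [_ iu] := (L2_integ_sqr _).1 Lu; have [_ iv] := (L2_integ_sqr _).1 Lv.
have iuv := L2_mul_integ Lu Lv; have iuv' := integ01Z 2 iuv.
have -> : L2norm (fadd u v) ^+ 2 =
    L2norm u ^+ 2 + 2 * int01 (fun t => u t * v t) + L2norm v ^+ 2.
  rewrite !L2norm_sqr -!int01Z// -!int01D//; last exact: integ01D.
  by apply: eq_Rintegral => t _; rewrite /fadd; ring.
have := ler_norm (int01 (fun t => u t * v t)); have := int01_CauchySchwarz Lu Lv; nra.
Qed.

Lemma L2normZ a u : L2 u -> L2norm (fscale a u) = `|a| * L2norm u.
Proof.
move=> Lu; have [_ iu] := (L2_integ_sqr _).1 Lu.
apply/eqP; rewrite -(@eqrXn2 _ 2) ?mulr_ge0 ?L2norm_ge0// exprMn real_normK ?num_real//.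
rewrite !L2norm_sqr -int01Z //; apply/eqP.
by apply: eq_Rintegral => t _; rewrite /fscale exprMn.
Qed.

Lemma L2norm_sup u M : measurable_fun I01 u -> (forall t, 0 <= t <= 1 -> `|u t| <= M) ->
  L2norm u <= M.
Proof.
move=> mu_ uM.
have M0 : 0 <= M by apply: le_trans (uM 0 _) => //; rewrite lexx ler01.
have /L2_integ_sqr[_ iu] := bounded_L2 mu_ uM.
rewrite -ler_sqr ?nnegrE ?L2norm_ge0// L2norm_sqr.
rewrite -[leRHS]int01_cst; apply: int01_le => //.
  by apply: L2_integ; exact: L2_cst.
move=> t tI; rewrite -(real_normK (num_real (u t))) lerXn2r ?nnegrE ?uM//.
Qed.

Lemma int01_norm u : integ01 u -> `|int01 u| <= int01 (fun t => `|u t|).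
Proof. exact: le_normr_Rintegral. Qed.

Lemma L2_abs u : L2 u -> L2 (fun t => `|u t|).
Proof.
move=> /L2_integ_sqr[mu_ iu]; apply/L2_integ_sqr; split; first exact: measurableT_comp.
by apply: eq_integrable iu => // t _ /=; rewrite real_normK ?num_real.
Qed.

#[global] Instance ae_mu_filter : Filter (nbhs (almost_everywhere mu)).
Proof. exact: (ae_filter_ringOfSetsType mu). Qed.

(** [ae01] speaks of the open interval, where two-sided derivatives live, and the integrals run over
    the closed one; the two endpoints form a null set. *)
Lemma ae01_ae_eq u v : ae01 u v -> ae_eq mu I01 (EFin \o u) (EFin \o v).
Proof.
move=> uv.
have h (a : R) : {ae mu, forall t, t != a}.
  exists [set a]; split => //; first exact: lebesgue_measure_set1.
  by move=> t /= /negP/negPn/eqP.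
have := h 0; have := h 1; apply: filterS3 uv => t h0 h1 h2 /in_I01 /andP[t0 t1] /=.
by rewrite h0 //= in_itv /= !lt_neqAle t0 t1 h1 eq_sym h2.
Qed.

Lemma ae01_int01 u v : measurable_fun I01 u -> measurable_fun I01 v -> ae01 u v ->
  int01 u = int01 v.
Proof.
move=> mu_ mv /ae01_ae_eq uv; congr fine.
by apply: ae_eq_integral => //; exact/measurable_EFinP.
Qed.

Lemma ae01_L2norm u v : measurable_fun I01 u -> measurable_fun I01 v -> ae01 u v ->
  L2norm u = L2norm v.
Proof.
move=> mu_ mv uv; apply/eqP; rewrite -(@eqrXn2 _ 2) ?L2norm_ge0// !L2norm_sqr; apply/eqP.
apply: ae01_int01; [exact: measurable_funX|exact: measurable_funX|].
by apply: filterS uv => t h /h ->.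
Qed.

Lemma L2norm0 : L2norm (fun=> 0 : R) = 0.
Proof.
apply/eqP; rewrite eq_le L2norm_ge0 andbT.
by apply: L2norm_sup => [|t _]; rewrite ?normr0//; exact: measurable_cst.
Qed.

Lemma ae01_L2norm_sub u v : L2 u -> L2 v -> ae01 u v -> L2norm (fsub u v) = 0.
Proof.
move=> Lu Lv uv; rewrite -L2norm0; apply: ae01_L2norm.
- exact: L2_meas (L2B Lu Lv).
- exact: measurable_cst.
by apply: filterS uv => t h /h; rewrite /fsub => ->; rewrite subrr.
Qed.

Lemma cont01_meas x : cont01 x -> measurable_fun I01 x.
Proof. by move=> cx; exact: subspace_continuous_measurable_fun. Qed.

Lemma cont01_bounded x : cont01 x -> exists2 M, 0 < M & forall t, 0 <= t <= 1 -> `|x t| <= M.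
Proof.
move=> cx; have [M [_ HM]] := compact_bounded (continuous_compact cx (@segment_compact R 0 1)).
exists (Num.max M 0 + 1); first by rewrite ltr_wpDl// le_max lexx orbT.
move=> t /in_I01 tI; apply: HM; last by exists t.
by rewrite ltr_pwDr// le_max lexx.
Qed.

Lemma cont01_L2 x : cont01 x -> L2 x.
Proof.
by move=> cx; have [M _ HM] := cont01_bounded cx; apply: bounded_L2 HM; exact: cont01_meas.
Qed.

Lemma cont01P x : cont01 x <-> forall t, 0 <= t <= 1 -> forall e, 0 < e ->
  exists2 d, 0 < d & forall s, 0 <= s <= 1 -> `|s - t| < d -> `|x s - x t| <= e.
Proof.
rewrite /cont01 subspace_continuousP; split=> [cx t /in_I01 tI e e0|H t /in_I01 tI].
  have /cvgrPdist_le/(_ e e0)[d /= d0 Hd] := cx t tI.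
  exists d => // s /in_I01 sI st; rewrite distrC; apply: Hd => //.
  by rewrite /ball /= distrC.
apply/cvgrPdist_le => e e0; have [d d0 Hd] := H t tI e e0.
exists d => //= s; rewrite /ball /= distrC => st /in_I01 sI; rewrite distrC; exact: Hd.
Qed.

End L2_theory.

(** * Calculus for absolutely continuous functions *)

Section H1_calculus.
Variable R : realType.
Local Notation mu := (@lebesgue_measure R).
Local Notation I01 := (`[0%R, 1%R]%classic : set R).
Implicit Types (u v w x : R -> R).

Let mI : measurable I01 := measurable_itv _.

Lemma AC01_cont x : AC01 x -> cont01 x.
Proof.
move=> ACx; apply/cont01P => t /andP[t0 t1] e e0; have [d d0 Hd] := ACx e e0.
exists d => // s /andP[s0 s1] st.
have := Hd 1%N (fun=> Num.min s t) (fun=> Num.max s t).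
have d11 i j : (i < 1)%N -> (j < 1)%N -> i <> j -> False.
  by rewrite !ltnS !leqn0 => /eqP-> /eqP->.
rewrite !big_ord1; have [ts|/ltW ts] := leP s t => H; apply: ltW.
  rewrite distrC; apply: H => // [i j i1 j1 /(d11 _ _ i1 j1)//|].
  by move: st; rewrite distrC ger0_norm// subr_ge0.
apply: H => // [i j i1 j1 /(d11 _ _ i1 j1)//|].
by move: st; rewrite ger0_norm// subr_ge0.
Qed.

Lemma AC01_ext x y : (forall t, 0 <= t <= 1 -> x t = y t) -> AC01 x -> AC01 y.
Proof.
move=> xy ACx e e0; have [d d0 Hd] := ACx e e0; exists d => // n a b ab dis len.
rewrite (eq_bigr (fun i : 'I_n => `|x (b i) - x (a i)|)); first exact: Hd.
move=> i _; have [a0 [aib b1]] := ab i (ltn_ord i).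
by rewrite !xy ?a0 ?b1 ?(le_trans a0) ?(le_trans aib).
Qed.

(** A common criterion for Lipschitz functions, sums and products. Two comparison functions are
    needed for products, where the increments of both factors appear. *)
Lemma AC01_Lip x y1 y2 K1 K2 : AC01 y1 -> AC01 y2 -> 0 <= K1 -> 0 <= K2 ->
  (forall s t, 0 <= s <= 1 -> 0 <= t <= 1 ->
     `|x s - x t| <= K1 * `|y1 s - y1 t| + K2 * `|y2 s - y2 t|) ->
  AC01 x.
Proof.
move=> AC1 AC2 K10 K20 H e e0.
have p0 : 0 < K1 + K2 + 1 by rewrite ltr_wpDl// addr_ge0.
have e'0 : 0 < e / (K1 + K2 + 1) by rewrite divr_gt0.
have [d1 d10 H1] := AC1 _ e'0; have [d2 d20 H2] := AC2 _ e'0.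
exists (Num.min d1 d2); first by rewrite lt_min d10.
move=> n a b ab dis; rewrite lt_min => /andP[l1 l2].
have {}H1 := H1 n a b ab dis l1; have {}H2 := H2 n a b ab dis l2.
apply: (@le_lt_trans _ _ (K1 * \sum_(i < n) `|y1 (b i) - y1 (a i)| +
   K2 * \sum_(i < n) `|y2 (b i) - y2 (a i)|)).
  rewrite !mulr_sumr -big_split /=; apply: ler_sum => i _.
  have [a0 [aib b1]] := ab i (ltn_ord i).
  by apply: H; rewrite ?a0 ?b1 ?(le_trans a0) ?(le_trans aib).
apply: (@le_lt_trans _ _ (K1 * (e / (K1 + K2 + 1)) + K2 * (e / (K1 + K2 + 1)))).
  by apply: lerD; rewrite ler_wpM2l// ltW.
by rewrite -mulrDl mulrCA gtr_pMr// ltr_pdivrMr// mul1r ltrDl.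
Qed.

Lemma AC01_id : AC01 (id : R -> R).
Proof.
move=> e e0; exists e => // n a b ab _; apply: le_lt_trans.
by apply: ler_sum => i _; have [_ [h _]] := ab i (ltn_ord i); rewrite ger0_norm ?subr_ge0.
Qed.

Lemma AC01_lipschitz x K : 0 <= K ->
  (forall s t, 0 <= s <= 1 -> 0 <= t <= 1 -> `|x s - x t| <= K * `|s - t|) -> AC01 x.
Proof.
move=> K0 H; apply: (@AC01_Lip _ id id K 0) => //; try exact: AC01_id.
by move=> s t sI tI; rewrite mul0r addr0; exact: H.
Qed.

Lemma AC01D x y : AC01 x -> AC01 y -> AC01 (fadd x y).
Proof.
move=> ax ay; apply: (@AC01_Lip _ x y 1 1) => // s t _ _; rewrite !mul1r /fadd.
by rewrite opprD addrACA ler_normD.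
Qed.

Lemma AC01M x y : AC01 x -> AC01 y -> AC01 (fun t => x t * y t).
Proof.
move=> ax ay; have [M M0 HM] := cont01_bounded (AC01_cont ax).
have [N N0 HN] := cont01_bounded (AC01_cont ay).
apply: (@AC01_Lip _ x y N M) => //; try exact: ltW.
move=> s t sI tI; have -> : x s * y s - x t * y t = (x s - x t) * y s + x t * (y s - y t) by ring.
apply: le_trans (ler_normD _ _) _; rewrite !normrM (mulrC _ `|y s|).
by apply: lerD; apply: ler_wpM2r; rewrite ?HM ?HN.
Qed.

Lemma AC01_cst (a : R) : AC01 (fun=> a).
Proof.
by apply: (@AC01_lipschitz _ 0) => // s t _ _; rewrite subrr normr0 mul0r.
Qed.

Lemma H1_cont x v : H1_with_deriv x v -> cont01 x.
Proof. by case=> /AC01_cont. Qed.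

Lemma H1_L2 x v : H1_with_deriv x v -> L2 v.
Proof. by case=> _ []. Qed.

Lemma H1_ext x y v : (forall t, 0 <= t <= 1 -> x t = y t) ->
  H1_with_deriv x v -> H1_with_deriv y v.
Proof.
move=> xy [ax [Lv dx]]; split; first exact: AC01_ext ax.
split => //; apply: filterS dx => t h tI; apply: near_eq_is_derive (h tI).
near=> s; apply: xy.
have : `]0%R, 1%R[%classic s by near: s; apply: near_in_itvoo; exact: tI.
by rewrite /= in_itv /= => /andP[s0 s1]; rewrite !ltW.
Unshelve. all: by end_near. Qed.

Lemma H1_ae x v w : L2 w -> ae01 v w -> H1_with_deriv x v -> H1_with_deriv x w.
Proof.
by move=> Lw vw [ax [Lv dx]]; split => //; split => //; apply: filterS2 vw dx => t h1 h2 tI; rewrite -h1//; exact: h2.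
Qed.

Lemma H1D x y v w : H1_with_deriv x v -> H1_with_deriv y w ->
  H1_with_deriv (fadd x y) (fadd v w).
Proof.
move=> [ax [Lv dx]] [ay [Lw dy]]; split; first exact: AC01D.
split; first exact: L2D.
by apply: filterS2 dx dy => t h1 h2 tI; have := is_deriveD (h1 tI) (h2 tI).
Qed.

Lemma H1M x y v w : H1_with_deriv x v -> H1_with_deriv y w ->
  H1_with_deriv (fun t => x t * y t) (fun t => x t * w t + y t * v t).
Proof.
move=> [ax [Lv dx]] [ay [Lw dy]]; split; first exact: AC01M.
have [M M0 HM] := cont01_bounded (AC01_cont ax).
have [N N0 HN] := cont01_bounded (AC01_cont ay).
split.
  apply: L2D; [apply: L2M_bounded HM Lw|apply: L2M_bounded HN Lv];
    exact: cont01_meas (AC01_cont _).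
by apply: filterS2 dx dy => t h1 h2 tI; exact: (is_deriveM (h1 tI) (h2 tI)).
Qed.

Lemma H1_cst (a : R) : H1_with_deriv (fun=> a) (fun=> 0).
Proof.
split; first exact: AC01_cst.
by split; [exact: L2_cst|apply: nearW => t _; exact: is_derive_cst].
Qed.

Lemma H1_id : H1_with_deriv id (fun=> 1 : R).
Proof.
split; first exact: AC01_id.
by split; [exact: L2_cst|apply: nearW => t _; exact: is_derive_id].
Qed.

Lemma H1Z a x v : H1_with_deriv x v -> H1_with_deriv (fscale a x) (fscale a v).
Proof.
move=> h; have := H1M (H1_cst a) h; congr H1_with_deriv.
by apply/funext => t; rewrite mulr0 addr0.
Qed.

Lemma H1B x y v w : H1_with_deriv x v -> H1_with_deriv y w ->
  H1_with_deriv (fsub x y) (fsub v w).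
Proof. by move=> hx hy; rewrite !fsubE; apply: H1D => //; exact: H1Z. Qed.

(* Restricting [w] to the unit interval makes [prim w] the primitive of an integrable
   function on the whole line, to which the library's differentiation theorem applies. *)
Definition prim w (t : R) : R := \int[mu]_(s in `[0%R, t]) (w \_ I01) s.

Lemma integrable_restrict01 w : L2 w -> mu.-integrable setT (EFin \o (w \_ I01)).
Proof.
move=> Lw; have := L2_integ Lw; rewrite /integ01 integrable_mkcond//.
by rewrite -restrict_EFin.
Qed.

Lemma primB w a b : L2 w -> 0 <= a -> a <= b -> b <= 1 ->
  prim w b - prim w a = int01 (fun t => w t * \1_(`]a, b]%classic : set R) t).
Proof.
move=> Lw a0 ab b1; rewrite /prim.
have iw : mu.-integrable [set` `[0, b]] (EFin \o (w \_ I01)).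
  apply: (@integrableS _ _ R mu setT); [exact: measurableT|exact: measurable_itv|by []|].
  exact: integrable_restrict01.
rewrite (Rintegral_itvB iw) ?bnd_simp//.
rewrite [LHS](_ : _ = \int[mu]_(t in I01 `&` `]a, b]) w t).
  rewrite Rintegral_mkcondr; apply: eq_Rintegral => t _.
  by rewrite patch_indic.
rewrite setIC Rintegral_mkcondr //.
Qed.

Lemma prim0 w : prim w 0 = 0.
Proof. by rewrite /prim set_itv1 Rintegral_set1. Qed.

Lemma prim1 w : prim w 1 = int01 w.
Proof. by rewrite /prim -Rintegral_mkcondr setIid. Qed.

Lemma int01_indic a b : 0 <= a -> a <= b -> b <= 1 ->
  int01 (\1_(`]a, b]%classic : set R)) = b - a.
Proof.
move=> a0 ab b1; rewrite /int01 /Rintegral integral_indic//.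
have -> : (`]a, b]%classic : set R) `&` I01 = `]a, b]%classic.
  apply: setIidl => t /=; rewrite !in_itv /= => /andP[at_ tb].
  by rewrite (le_trans tb)// (le_trans a0)// ltW.
have h := @lebesgue_measure_itv R `]a, b]; rewrite [X in fine X]h /= lte_fin.
by case: ltgtP ab => //= ->; rewrite subrr.
Qed.

Lemma int01_sum n (u_ : nat -> R -> R) : (forall i, (i < n)%N -> integ01 (u_ i)) ->
  integ01 (fun t => \sum_(i < n) u_ i t) /\
  int01 (fun t => \sum_(i < n) u_ i t) = \sum_(i < n) int01 (u_ i).
Proof.
elim: n => [|n IH] H.
  rewrite big_ord0; under eq_fun do rewrite big_ord0.
  by split; [exact/L2_integ/L2_cst|exact: int01_cst].
have [i1 e1] := IH (fun i ilt => H i (ltnW ilt)).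
rewrite big_ord_recr /= -e1; under eq_fun do rewrite big_ord_recr /=.
by split; [apply: integ01D|apply: int01D] => //; exact: H.
Qed.

(** If [chi] is the indicator of the union of the intervals, the sum of increments is at most
    [int |w| chi], hence by Cauchy-Schwarz at most [|w|] times the square root of the total length.
    This dictates the choice of [delta]; the [+ 1] keeps the denominator positive. *)
Lemma AC01_prim w : L2 w -> AC01 (prim w).
Proof.
move=> Lw e e0.
have K0 : 0 < L2norm w + 1 by rewrite ltr_wpDl// L2norm_ge0.
exists ((e / (L2norm w + 1)) ^+ 2); first by rewrite exprn_gt0// divr_gt0.
move=> n a b ab dis len.
(* Half-open intervals stay disjoint when neighbours share an endpoint, so [chi <= 1] everywhere. *)
pose A i : set R := `]a i, b i]%classic.
have mA i : measurable (A i) by exact: measurable_itv.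
pose chi t : R := \sum_(i < n) \1_(A i) t.
have L1 i : L2 (\1_(A i) : R -> R).
  apply: (@bounded_L2 _ _ 1); first exact: measurable_indic.
  by move=> t _; rewrite indicE; case: (_ \in _); rewrite ?normr1 ?normr0.
have chi01 t : 0 <= chi t <= 1.
  rewrite sumr_ge0 /= => [|i _]; last by rewrite indicE ler0n.
  have [[i ti]|no] := pselect (exists i : 'I_n, A i t).
    rewrite /chi (bigD1 i) //= big1 ?addr0.
      by rewrite indicE; case: (_ \in _).
    move=> j ji; rewrite indicE memNset// => tj.
    have ij : (i : nat) <> j by move=> h; move/eqP : ji; apply; exact/val_inj.
    move: ti tj; rewrite /A /= !in_itv /= => /andP[ait tbi] /andP[ajt tbj].
    have [h|h] := dis _ _ (ltn_ord i) (ltn_ord j) ij.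
      by move: (lt_le_trans ajt tbi) => /lt_le_trans/(_ h); rewrite ltxx.
    by move: (lt_le_trans ait tbj) => /lt_le_trans/(_ h); rewrite ltxx.
  by rewrite /chi big1// => i _; rewrite indicE memNset// => ti; apply: no; exists i.
have [ichi echi] := int01_sum (fun i (_ : (i < n)%N) => L2_integ (L1 i)).
have mchi : measurable_fun I01 chi by exact: integ01_meas ichi.
have Lchi : L2 chi.
  by apply: (@bounded_L2 _ _ 1) => // t _; have /andP[? ?] := chi01 t; rewrite ger0_norm.
have Nchi : L2norm chi < e / (L2norm w + 1).
  rewrite -ltr_sqr ?nnegrE ?L2norm_ge0 ?divr_ge0 ?ltW// L2norm_sqr.
  apply: le_lt_trans len.
  have -> : \sum_(i < n) (b i - a i) = int01 chi.
    rewrite echi; apply: eq_bigr => i _; have [? [? ?]] := ab i (ltn_ord i).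
    by rewrite int01_indic.
  apply: int01_le => //; first by have /L2_integ_sqr[] := Lchi.
  by move=> t _; have /andP[? ?] := chi01 t; rewrite expr2 ler_piMl.
apply: (@le_lt_trans _ _ (int01 (fun t => `|w t| * chi t))).
  have iw i : (i < n)%N -> integ01 (fun t => `|w t| * \1_(A i) t).
    by move=> _; apply: L2_mul_integ => //; exact: L2_abs.
  have [_ e1] := int01_sum iw.
  rewrite [leRHS](_ : _ = \sum_(i < n) int01 (fun t => `|w t| * \1_(A i) t)); last first.
    by rewrite -e1; apply: eq_Rintegral => t _; rewrite /chi mulr_sumr.
  apply: ler_sum => i _; have [? [? ?]] := ab i (ltn_ord i).
  rewrite primB//; apply: le_trans (int01_norm (L2_mul_integ Lw (L1 i))) _.
  rewrite le_eqVlt; apply/orP; left; apply/eqP; apply: eq_Rintegral => t _.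
  by rewrite normrM; congr (_ * _); rewrite ger0_norm// /A indicE; case: (_ \in _).
have := int01_CauchySchwarz (L2_abs Lw) Lchi.
move=> /(le_trans (ler_norm _)) /= CS; apply: (le_lt_trans CS).
have -> : L2norm (fun t => `|w t|) = L2norm w.
  apply/eqP; rewrite -(@eqrXn2 _ 2) ?L2norm_ge0// !L2norm_sqr; apply/eqP.
  by apply: eq_Rintegral => t _; rewrite real_normK ?num_real.
apply: (@le_lt_trans _ _ ((L2norm w + 1) * L2norm chi)).
  by rewrite ler_wpM2r ?L2norm_ge0// lerDl.
by rewrite -ltr_pdivlMl// mulrC.
Qed.

Lemma H1_prim w : L2 w -> H1_with_deriv (prim w) w.
Proof.
move=> Lw; split; first exact: AC01_prim.
split => //.
have iw := integrable_restrict01 Lw.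
have iy (y : R) : mu.-integrable [set` Interval (BLeft 0) (BRight y)] (EFin \o (w \_ I01)).
  by apply: (@integrableS _ _ R mu setT); [exact: measurableT|exact: measurable_itv|by []|].
have lw : locally_integrable [set: R] (w \_ I01).
  by apply: integrable_locally => //; exact: L2_integ.
have /= := FTC1 iy lw; rewrite -/mu.
apply: filterS => t h; rewrite /= in_itv /= => /andP[t0 t1].
have [|dt et] := h; first by rewrite lte_fin.
split => //; rewrite -derive1E et patchE mem_set//=.
by rewrite in_itv /= !ltW.
Qed.

(** [x - prim v] is absolutely continuous with zero derivative almost everywhere, hence constant. *)
Lemma H1_FTC x v t : H1_with_deriv x v -> 0 <= t <= 1 -> x t = x 0 + prim v t.
Proof.
move=> hx tI; have hv := H1_prim (H1_L2 hx).
have [ax [_ dx]] := H1B hx hv.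
have : fsub x (prim v) t = fsub x (prim v) 0.
  apply: AC01_deriv0_cst ax _ _ tI; apply: filterS dx => s h /h.
  by rewrite /fsub subrr.
by rewrite /fsub prim0 subr0 => <-; rewrite subrK.
Qed.

Lemma H1_FTC1 x v : H1_with_deriv x v -> int01 v = x 1 - x 0.
Proof.
move=> hx; rewrite -prim1 (@H1_FTC x v 1 hx); last by rewrite ler01 lexx.
by rewrite addrAC subrr add0r.
Qed.

Lemma prim_bound w t : L2 w -> 0 <= t <= 1 -> `|prim w t| <= L2norm w.
Proof.
move=> Lw /andP[t0 t1]; rewrite -[prim w t]subr0 -(prim0 w) primB//.
pose A : set R := `]0%R, t]%classic.
have mA : measurable A by exact: measurable_itv.
have L1 : L2 (\1_A : R -> R).
  apply: (@bounded_L2 _ _ 1); first exact: measurable_indic.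
  by move=> s _; rewrite indicE; case: (_ \in _); rewrite ?normr1 ?normr0.
apply: le_trans (int01_CauchySchwarz Lw L1) _; rewrite ler_piMr ?L2norm_ge0//.
apply: L2norm_sup; first exact: measurable_indic.
by move=> s _; rewrite indicE; case: (_ \in _); rewrite ?normr1 ?normr0.
Qed.

Lemma H1_deriv_unique x v w : H1_with_deriv x v -> H1_with_deriv x w -> ae01 v w.
Proof.
move=> [_ [_ h1]] [_ [_ h2]]; apply: filterS2 h1 h2 => t h1 h2 tI.
by rewrite -(@derive_val _ _ _ _ _ _ _ (h1 tI)) (@derive_val _ _ _ _ _ _ _ (h2 tI)).
Qed.

(* [x^2] has zero derivative almost everywhere, hence is constant, with integral 0. *)
Lemma H1_ae0 x v : H1_with_deriv x v -> ae01 x (fun=> 0) ->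
  forall t, 0 <= t <= 1 -> x t = 0.
Proof.
move=> hx x0.
have cx := H1_cont hx; have Lx := cont01_L2 cx.
have [ax2 [_ d2]] := H1M hx hx.
have cst t : 0 <= t <= 1 -> x t * x t = x 0 * x 0.
  apply: AC01_deriv0_cst ax2 _ t; apply: filterS2 x0 d2 => s h1 h2 sI.
  by have := h2 sI; rewrite h1// !mul0r addr0.
have : int01 (fun t => x t * x t) = int01 (fun=> 0).
  apply: ae01_int01; [apply: measurable_funM; exact: L2_meas|exact: measurable_cst|].
  by apply: filterS x0 => t h /h ->; rewrite mulr0.
rewrite [LHS](_ : _ = int01 (fun=> x 0 * x 0)); last first.
  by apply: eq_Rintegral => t; rewrite inE => /in_I01; exact: cst.
rewrite !int01_cst => x00 t tI; apply/eqP; rewrite -sqrf_eq0 expr2 cst// x00//.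
Qed.

End H1_calculus.

(** * The Dirichlet problem and the energy estimate *)

Section Dirichlet.
Variable R : realType.
Local Notation mu := (@lebesgue_measure R).
Local Notation I01 := (`[0%R, 1%R]%classic : set R).
Implicit Types (u v w x y k : R -> R).

Definition D2 x w := exists v, [/\ H1_with_deriv x v, H1_with_deriv v w, x 0 = 0 & x 1 = 0].

Lemma D2_L2 x w : D2 x w -> L2 w.
Proof. by move=> [v [_ /H1_L2]]. Qed.

Lemma D2_cont x w : D2 x w -> cont01 x.
Proof. by move=> [v [/H1_cont]]. Qed.

Lemma D2_ext x y w : (forall t, 0 <= t <= 1 -> x t = y t) -> D2 x w -> D2 y w.
Proof.
move=> xy [v [hx hv x0 x1]]; exists v; split => //; first exact: H1_ext hx.
  by rewrite -xy // lexx ler01.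
by rewrite -xy // lexx ler01.
Qed.

Lemma D2_ae x w1 w2 : L2 w2 -> ae01 w1 w2 -> D2 x w1 -> D2 x w2.
Proof. by move=> L ww [v [hx hv x0 x1]]; exists v; split => //; exact: H1_ae hv. Qed.

Lemma D2_eq x w1 w2 : (forall t, 0 <= t <= 1 -> w1 t = w2 t) -> D2 x w1 -> D2 x w2.
Proof.
move=> ww hx; have Lw := D2_L2 hx; have Lw2 : L2 w2.
  have [mw iw] := (L2_integ_sqr _).1 Lw; apply/L2_integ_sqr; split.
    by apply: eq_measurable_fun mw => t; rewrite inE => /in_I01 /ww.
  by apply: eq_integrable iw => // t; rewrite inE => /in_I01 /ww /= ->.
apply: D2_ae hx => //; apply: nearW => t; rewrite /= in_itv /= => /andP[t0 t1].
by apply: ww; rewrite !ltW.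
Qed.

Lemma D2D x y w1 w2 : D2 x w1 -> D2 y w2 -> D2 (fadd x y) (fadd w1 w2).
Proof.
move=> [v1 [hx hv x0 x1]] [v2 [hy hv2 y0 y1]]; exists (fadd v1 v2).
by split; [exact: H1D|exact: H1D|rewrite /fadd x0 y0 addr0|rewrite /fadd x1 y1 addr0].
Qed.

Lemma D2Z a x w : D2 x w -> D2 (fscale a x) (fscale a w).
Proof.
move=> [v1 [hx hv x0 x1]]; exists (fscale a v1).
by split; [exact: H1Z|exact: H1Z|rewrite /fscale x0 mulr0|rewrite /fscale x1 mulr0].
Qed.

Lemma D2B x y w1 w2 : D2 x w1 -> D2 y w2 -> D2 (fsub x y) (fsub w1 w2).
Proof. by move=> hx hy; rewrite !fsubE; apply: D2D => //; exact: D2Z. Qed.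

Lemma D2_exists w : L2 w -> exists x, D2 x w.
Proof.
move=> Lw; have h1 := H1_prim Lw.
have h2 := H1_prim (cont01_L2 (H1_cont h1)).
have h3 := H1Z (prim (prim w) 1) (@H1_id R).
exists (fsub (prim (prim w)) (fscale (prim (prim w) 1) id)).
exists (fsub (prim w) (fscale (prim (prim w) 1) (fun=> 1))); split.
- exact: H1B.
- have := H1B h1 (H1Z (prim (prim w) 1) (H1_cst (1 : R))); congr H1_with_deriv.
  by apply/funext => t; rewrite /fsub /fscale mulr0 subr0.
- by rewrite /fsub /fscale prim0 mulr0 subr0.
- by rewrite /fsub /fscale mulr1 subrr.
Qed.

(** The two first derivatives agree almost everywhere at first. Their difference is itself
    absolutely continuous, so it vanishes at every point, and only then can the second derivatives
    be compared. *)
Lemma D2_unique x w1 w2 : D2 x w1 -> D2 x w2 -> ae01 w1 w2.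
Proof.
move=> [v1 [hx1 hv1 _ _]] [v2 [hx2 hv2 _ _]].
have hB := H1B hv1 hv2.
have z : ae01 (fsub v1 v2) (fun=> 0).
  by apply: filterS (H1_deriv_unique hx1 hx2) => t h /h; rewrite /fsub => ->; rewrite subrr.
have hB0 := H1_ext (H1_ae0 hB z) hB.
apply: filterS (H1_deriv_unique hB0 (H1_cst 0)) => t h /h /eqP.
by rewrite subr_eq0 => /eqP.
Qed.

(* The integrand is the derivative of [x v - p x^2], which vanishes at 0 and 1. *)
Lemma energy_identity x v w p q : H1_with_deriv x v -> H1_with_deriv v w ->
  x 0 = 0 -> x 1 = 0 -> H1_with_deriv p q ->
  L2 (fun t => v t ^+ 2 + x t * w t - 2 * p t * x t * v t - q t * x t ^+ 2) /\
  int01 (fun t => v t ^+ 2 + x t * w t - 2 * p t * x t * v t - q t * x t ^+ 2) = 0.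
Proof.
move=> hx hv x0 x1 hp.
have h := H1B (H1M hx hv) (H1M hp (H1M hx hx)).
have := H1_L2 h; have := H1_FTC1 h.
rewrite {2 3}/fsub x0 x1 !(mul0r, mulr0) !subr0.
rewrite [X in int01 X](_ : _ = (fun t => v t ^+ 2 + x t * w t - 2 * p t * x t * v t - q t * x t ^+ 2)).
  by rewrite [X in L2 X](_ : _ = (fun t => v t ^+ 2 + x t * w t - 2 * p t * x t * v t - q t * x t ^+ 2)) //;
    apply/funext => t; rewrite /fsub; ring.
by apply/funext => t; rewrite /fsub; ring.
Qed.

Lemma derive_bounded_AC01 (p q : R -> R) (K : R) : (forall t : R, 0 <= t <= 1 -> is_derive t 1 p (q t)) ->
  0 <= K -> (forall t, 0 <= t <= 1 -> `|q t| <= K) -> AC01 p.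
Proof.
move=> dp K0 qK; apply: (@AC01_lipschitz _ _ K) => // s t.
wlog st : s t / s <= t.
  move=> H sI tI; have [st|/ltW ts] := leP s t; first exact: H.
  by rewrite distrC (distrC s); exact: H.
move=> /andP[s0 _] /andP[_ t1].
have in01 z : z \in `[s, t] -> 0 <= z <= 1.
  by rewrite in_itv /= => /andP[sz zt]; rewrite (le_trans s0)//= (le_trans zt).
have [c cst e] : exists2 c, c \in `[s, t]%R & p t - p s = q c * (t - s).
  apply: MVT_segment => //.
    by move=> z zst; apply: dp; apply: in01; exact: subset_itv_oo_cc zst.
  apply: continuous_in_subspaceT => z; rewrite inE => /in01/dp[dz _].
  exact/differentiable_continuous/derivable1_diffP.
by rewrite distrC (distrC s) e normrM ler_wpM2r// qK// in01.
Qed.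

Lemma riccati_exists (l : R) : 0 <= l < pi -> exists p,
  H1_with_deriv p (fun t => - l ^+ 2 - p t ^+ 2).
Proof.
move=> /andP[l0 lpi].
(* Centring at [1/2] keeps the argument within [l / 2 < pi / 2] in absolute value on the whole
   interval, where the cosine is positive. *)
pose th (t : R) := l * (t - 2^-1).
pose p t := - l * tan (th t).
have cos0 t : 0 <= t <= 1 -> 0 < cos (th t).
  move=> /andP[t0 t1]; apply: cos_gt0_pihalf; rewrite /th.
  have : l * t <= l by rewrite ler_piMr.
  have : 0 <= l * t by rewrite mulr_ge0.
  by move=> ? ?; apply/andP; split; lra.
have dp (t : R) : 0 <= t <= 1 -> is_derive t 1 p (- l ^+ 2 - p t ^+ 2).
  move=> /cos0 c0; have cn0 : cos (th t) != 0 by rewrite gt_eqF.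
  have dth : is_derive t 1 th l.
    have := is_deriveZ l (is_deriveB (is_derive_id t 1) (is_derive_cst (2^-1 : R) t 1)).
    by move/is_derive_eq; apply; rewrite subr0 /GRing.scale /= mulr1.
  have dt : is_derive (th t) 1 tan ((cos (th t)) ^- 2) by exact: is_derive_tan.
  have := is_deriveZ (- l) (is_derive1_comp dt dth).
  move/is_derive_eq; apply; rewrite /p /GRing.scale /= /tan.
  rewrite exprMn sqrrN expr_div_n sin2cos2; field.
  exact: cn0.
have cp : cont01 p.
  apply: continuous_in_subspaceT => z; rewrite inE => /in_I01/dp[dz _].
  exact/differentiable_continuous/derivable1_diffP.
have [M M0 HM] := cont01_bounded cp.
have qM t : 0 <= t <= 1 -> `|- l ^+ 2 - p t ^+ 2| <= l ^+ 2 + M ^+ 2.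
  move=> tI; rewrite -opprD normrN ger0_norm ?addr_ge0 ?sqr_ge0// lerD2l.
  by rewrite -(real_normK (num_real (p t))) lerXn2r ?nnegrE ?HM//; exact: ltW.
exists p; split; first by apply: derive_bounded_AC01 dp _ qM; rewrite addr_ge0 ?sqr_ge0.
split.
  apply: bounded_L2 qM; apply: measurable_funB; first exact: measurable_cst.
  by apply: measurable_funX; exact: cont01_meas.
apply: nearW => t; rewrite /= in_itv /= => /andP[t0 t1].
by apply: dp; rewrite !ltW.
Qed.

(** With [q = - l^2 - p^2] the integrand of [energy_identity] becomes [(v - p x)^2 + x w + l^2 x^2];
    dropping the square gives the inequality. *)
Lemma poincare x w l : D2 x w -> 0 <= l < pi ->
  l ^+ 2 * L2norm x ^+ 2 <= - int01 (fun t => x t * w t).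
Proof.
move=> hx' /riccati_exists[p hp]; have Lw := D2_L2 hx'; have cx := D2_cont hx'.
have Lx := cont01_L2 cx; move: hx' => [v [hx hv x0 x1]].
have [Le eq0] := energy_identity hx hv x0 x1 hp.
have [_ ix] := (L2_integ_sqr _).1 Lx; have ixw := L2_mul_integ Lx Lw.
rewrite -subr_ge0 -opprD oppr_ge0 L2norm_sqr -int01Z// -int01D//; last exact: integ01Z.
rewrite -eq0; apply: int01_le; [|exact: L2_integ|].
  by apply: integ01D => //; exact: integ01Z.
move=> t _; rewrite -subr_ge0; have := sqr_ge0 (v t - p t * x t).
congr (0 <= _); ring.
Qed.

(** The energy identity with [p = 0] says that [|v|^2 = - int x w], and [x(t)], the integral of [v]
    from 0, is at most the L2 norm of [v]. *)
Lemma D2_sup x v w : H1_with_deriv x v -> H1_with_deriv v w -> x 0 = 0 -> x 1 = 0 ->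
  forall t, 0 <= t <= 1 -> `|x t| ^+ 2 <= - int01 (fun t => x t * w t).
Proof.
move=> hx hv x0 x1 t tI.
have [_ eq0] := energy_identity hx hv x0 x1 (H1_cst 0).
have Lv := H1_L2 hx; have Lw := H1_L2 hv; have Lx := cont01_L2 (H1_cont hx).
have [_ iv] := (L2_integ_sqr _).1 Lv; have ixw := L2_mul_integ Lx Lw.
have {eq0} : L2norm v ^+ 2 = - int01 (fun t => x t * w t).
  apply/eqP; rewrite -subr_eq0 opprK L2norm_sqr -int01D//; apply/eqP; rewrite -[RHS]eq0.
  by apply: eq_Rintegral => s _; ring.
move=> <-; rewrite (H1_FTC hx tI) x0 add0r lerXn2r ?nnegrE ?L2norm_ge0//.
by apply: prim_bound => //; exact: H1_L2 hx.
Qed.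

Lemma energy_bound (c : R) : 0 <= c -> c < pi ^+ 2 ->
  exists2 C, 0 < C & forall x w k, D2 x w -> L2 k ->
    (forall t, 0 <= t <= 1 -> - (c * x t ^+ 2) <= (w t - k t) * x t) ->
    forall t, 0 <= t <= 1 -> `|x t| <= C * L2norm k.
Proof.
move=> c0 cpi.
(* [l ^+ 2] is the midpoint of [c] and [pi ^+ 2]: below [pi ^+ 2] for the Poincare inequality, above
   [c] for a positive gap [g]. *)
pose l := Num.sqrt ((c + pi ^+ 2) / 2).
have l2 : l ^+ 2 = (c + pi ^+ 2) / 2 by rewrite sqr_sqrtr// divr_ge0// addr_ge0// sqr_ge0.
have lpi : 0 <= l < pi.
  by rewrite sqrtr_ge0 /= -ltr_sqr ?nnegrE ?sqrtr_ge0 ?pi_ge0// l2; lra.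
pose g := l ^+ 2 - c; have g0 : 0 < g by rewrite /g l2; lra.
(* With [X], [N] the L2 norms of [x] and [k], the Poincare inequality gives [g X <= N], so the sup
   norm squared is at most [X N + c X^2 <= a N^2] with [a = 1/g + c/g^2]. The constant is [1 + a],
   since [a <= (1 + a)^2] avoids a square root. *)
exists (1 + g^-1 + c / g ^+ 2).
  by rewrite ltr_wpDr ?divr_ge0 ?sqr_ge0// addr_gt0// invr_gt0.
move=> x w k hD Lk hk t tI.
have Lw := D2_L2 hD; have Lx := cont01_L2 (D2_cont hD).
have ixw := L2_mul_integ Lx Lw; have ixk := L2_mul_integ Lx Lk.
have [_ ix] := (L2_integ_sqr _).1 Lx.
set N := L2norm k; set X := L2norm x.
have N0 : 0 <= N := L2norm_ge0 k; have X0 : 0 <= X := L2norm_ge0 x.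
have E : - int01 (fun t => x t * w t) <= X * N + c * X ^+ 2.
  have CS := int01_CauchySchwarz Lx Lk.
  have : - int01 (fun t => x t * k t) <= X * N by rewrite (le_trans _ CS)// -normrN ler_norm.
  suff : int01 (fun t => x t * k t) <= int01 (fun t => x t * w t) + c * X ^+ 2.
    by rewrite -/X -/N; lra.
  rewrite L2norm_sqr -int01Z// -int01D//; last exact: integ01Z.
  apply: int01_le => //; first by apply: integ01D => //; exact: integ01Z.
  by move=> s /hk; lra.
have XN : g * X <= N.
  have P := poincare hD lpi.
  have [->|Xn0] := eqVneq X 0; first by rewrite mulr0.
  have Xp : 0 < X by rewrite lt_def Xn0.
  rewrite -(ler_pM2l Xp); move: (le_trans P E); rewrite -/X /g; lra.
have {}XN : X <= N / g by rewrite ler_pdivlMr// mulrC.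
have S : `|x t| ^+ 2 <= (g^-1 + c / g ^+ 2) * N ^+ 2.
  move: hD => [v [hx hv x0 x1]].
  apply: le_trans (D2_sup hx hv x0 x1 tI) (le_trans E _).
  rewrite mulrDl; apply: lerD.
    by rewrite expr2 mulrA ler_wpM2r// mulrC.
  rewrite -mulrA ler_wpM2l// [_^-1 * _]mulrC -expr_div_n lerXn2r// nnegrE.
  by rewrite divr_ge0// ltW.
have gc0 : 0 <= g^-1 + c / g ^+ 2 by rewrite addr_ge0 ?divr_ge0 ?sqr_ge0// invr_ge0 ltW.
rewrite -ler_sqr ?nnegrE ?mulr_ge0 //; last by rewrite -addrA addr_ge0.
apply: le_trans S _; rewrite exprMn ler_wpM2r ?sqr_ge0// -addrA.
by move: (_ + _) gc0 => a a0; nra.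
Qed.

End Dirichlet.

(** * Existence for Lipschitz nonlinearities *)

Lemma geometric_le0 (R : realType) (a K : R) : (forall n, a <= K / 2 ^+ n) -> a <= 0.
Proof.
move=> H; rewrite leNgt; apply/negP => a0.
have h := archi_boundP (_ : 0 <= `|K / a|); have {}h := h (normr_ge0 _).
have := H (Num.bound `|K / a|); rewrite ler_pdivlMr ?exprn_gt0// leNgt => /negP; apply.
rewrite mulrC -ltr_pdivrMr// (le_lt_trans (ler_norm _))// (lt_trans h)//.
by rewrite -natrX ltr_nat ltn_expl.
Qed.

(** The intervals of radius [2 M / 2 ^+ n] about [u_ n] are nested, and the limit is the supremum of
    their left ends. The rate depends on [M] only, so limits taken pointwise in [t] are uniform. *)
Lemma geometric_cauchy_cvg (R : realType) (u_ : nat -> R) (M : R) :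
  (forall n, `|u_ n.+1 - u_ n| <= M / 2 ^+ n) ->
  exists l, forall n, `|l - u_ n| <= 2 * M / 2 ^+ n.
Proof.
move=> H; pose e n := 2 * M / 2 ^+ n.
have eS n : e n = 2 * e n.+1 by rewrite /e exprS; field; rewrite expf_neq0.
have He n : `|u_ n.+1 - u_ n| <= e n.+1.
  by rewrite (le_trans (H n))// /e exprS -mulf_div divff// mul1r.
have e0 n : 0 <= e n by rewrite eS mulr_ge0// (le_trans _ (He n)).
pose a n := u_ n - e n; pose b n := u_ n + e n.
have aS n : a n <= a n.+1.
  by have := He n; have := eS n; rewrite ler_norml /a => ? /andP[? ?]; lra.
have bS n : b n.+1 <= b n.
  by have := He n; have := eS n; rewrite ler_norml /b => ? /andP[? ?]; lra.
have am n m : a n <= a (n + m)%N.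
  by elim: m => [|m IH]; rewrite ?addn0// addnS (le_trans IH).
have bm n m : b (n + m)%N <= b n.
  by elim: m => [|m IH]; rewrite ?addn0// addnS (le_trans (bS _)).
have ab n m : a n <= b m.
  apply: le_trans (am n m) (le_trans _ (bm m n)); rewrite (addnC m).
  by rewrite /a /b; have := e0 (n + m)%N; lra.
have ub : has_ubound (range a) by exists (b 0%N) => _ [n _ <-].
exists (sup (range a)) => n; rewrite ler_distl; apply/andP; split.
  by apply: ub_le_sup ub _ _; exists n.
by apply: ge_sup => [|_ [m _ <-]]; [exists (a 0%N), 0%N|exact: ab].
Qed.

(** * Continuation in the parameter of a Lipschitz nonlinearity *)

Section Solver.
Variable R : realType.
Implicit Types (x y z w k : R -> R).

Lemma cont01_geometric_lim (x_ : nat -> R -> R) x (M : R) : (forall n, cont01 (x_ n)) ->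
  (forall n t, 0 <= t <= 1 -> `|x t - x_ n t| <= M / 2 ^+ n) -> cont01 x.
Proof.
move=> cx H; apply/cont01P => t tI e e0.
have [n Hn] : exists n, M / 2 ^+ n <= e / 3.
  apply: contrapT => no; suff : e / 3 <= 0 by lra.
  apply: (@geometric_le0 _ _ M) => n; apply: ltW; rewrite ltNge; apply/negP => h.
  by apply: no; exists n.
have e3 : 0 < e / 3 by lra.
have [d d0 Hd] := (cont01P _).1 (cx n) t tI _ e3.
exists d => // s sI st.
have h1 := le_trans (H n s sI) Hn; have h2 := le_trans (H n t tI) Hn.
have h3 := Hd s sI st; move: h1 h2 h3; rewrite !ler_norml.
by move=> /andP[? ?] /andP[? ?] /andP[? ?]; apply/andP; split; lra.
Qed.

Variables (g : R -> R -> R) (c L : R).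
Hypothesis c0 : 0 <= c.
Hypothesis cpi : c < pi ^+ 2.
Hypothesis L0 : 0 <= L.
Hypothesis gcont : forall x, cont01 x -> cont01 (fun t => g t (x t)).
Hypothesis gLip : forall t a b, 0 <= t <= 1 -> `|g t a - g t b| <= L * `|a - b|.
Hypothesis gmon : forall t a b, 0 <= t <= 1 ->
  - (c * (a - b) ^+ 2) <= (g t a - g t b) * (a - b).

Let G x : R -> R := fun t => g t (x t).

(* Picard iteration [x_(n+1) = S (y + d g(x_n))], with [S] the solution operator at
   parameter [tau]; the condition on [d] makes it contract by a factor 2. *)
Lemma solver_step (C tau d : R) : 0 < C ->
  (forall x w k, D2 x w -> L2 k ->
    (forall t, 0 <= t <= 1 -> - (c * x t ^+ 2) <= (w t - k t) * x t) ->
    forall t, 0 <= t <= 1 -> `|x t| <= C * L2norm k) ->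
  0 <= tau -> 0 <= d -> tau + d <= 1 -> C * (d * L) <= 2^-1 ->
  (forall y, L2 y -> exists x, D2 x (fadd y (fscale tau (G x)))) ->
  forall y, L2 y -> exists x, D2 x (fadd y (fscale (tau + d) (G x))).
Proof.
move=> C0 EB tau0 d0 td1 CdL Hsol y Ly.
have LG x : cont01 x -> L2 (G x) by move=> cx; apply/cont01_L2/gcont.
(* [choice] needs a witness for every function, so [z] itself is a dummy value outside L2. *)
have /choice[S HS] : forall z, exists x, L2 z -> D2 x (fadd z (fscale tau (G x))).
  move=> z; have [Lz|nLz] := pselect (L2 z); last by exists z.
  by have [x hx] := Hsol z Lz; exists x.
pose Phi x := S (fadd y (fscale d (G x))).
pose x_ n := iter n Phi (S y).
have cx n : cont01 (x_ n).
  elim: n => [|n IH]; first exact: D2_cont (HS _ Ly).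
  by apply: D2_cont (HS _ _); apply: L2D => //; exact/L2Z/LG.
have hx n : D2 (x_ n.+1) (fadd (fadd y (fscale d (G (x_ n)))) (fscale tau (G (x_ n.+1)))).
  by apply: HS; apply: L2D => //; exact/L2Z/LG.
have [M1 M10 HM1] := cont01_bounded (cx 0%N).
have [M2 M20 HM2] := cont01_bounded (cx 1%N).
pose M := M1 + M2.
have Hn n t : 0 <= t <= 1 -> `|x_ n.+1 t - x_ n t| <= M / 2 ^+ n.
  elim: n t => [|n IH] t tI.
    rewrite expr0 divr1 (le_trans (ler_normB _ _))// /M addrC.
    by apply: lerD; [exact: HM1|exact: HM2].
  (* In the difference of two consecutive equations [k] collects the explicit terms. The implicit
     ones carry the factor [tau], and the one-sided bound [- c] survives because [0 <= tau <= 1]. *)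
  pose k := fscale d (fsub (G (x_ n.+1)) (G (x_ n))).
  have Lk : L2 k by apply/L2Z/L2B; exact: LG.
  have := EB _ _ k (D2B (hx n.+1) (hx n)) Lk; move=> /(_ _ t tI) h.
  apply: le_trans (h _) _ => {h}.
    move=> s sI; rewrite /k /fsub /fadd /fscale /G.
    have := gmon (x_ n.+2 s) (x_ n.+1 s) sI.
    have : 0 <= c * (x_ n.+2 s - x_ n.+1 s) ^+ 2 by rewrite mulr_ge0// sqr_ge0.
    move: (g s (x_ n s)) (x_ n.+2 s) (x_ n.+1 s) => g0 a b; set q := c * _ => q0 h.
    have -> : (y s + d * g s b + tau * g s a - (y s + d * g0 + tau * g s b) - d * (g s b - g0)) * (a - b)
       = tau * ((g s a - g s b) * (a - b)) by ring.
    apply: le_trans (_ : - (tau * q) <= _); last by rewrite -mulrN ler_wpM2l.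
    by rewrite lerN2 ler_piMl//; lra.
  have kM : L2norm k <= d * L * (M / 2 ^+ n).
    apply: L2norm_sup => [|s sI]; first exact: L2_meas.
    rewrite /k /fscale /fsub /G normrM (ger0_norm d0) -mulrA ler_wpM2l//.
    by apply: le_trans (gLip _ _ sI) _; rewrite ler_wpM2l// IH.
  have M0 : 0 <= M / 2 ^+ n by rewrite divr_ge0 ?exprn_ge0// addr_ge0// ltW.
  apply: (@le_trans _ _ (C * (d * L) * (M / 2 ^+ n))).
    by rewrite -mulrA ler_wpM2l// ltW.
  have -> : M / 2 ^+ n.+1 = 2^-1 * (M / 2 ^+ n) by rewrite exprS invfM mulrCA.
  by rewrite ler_wpM2r.
have lim (t : R) : exists l, 0 <= t <= 1 -> forall n, `|l - x_ n t| <= 2 * M / 2 ^+ n.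
  have [tI|nt] := pselect (0 <= t <= 1); last by exists 0.
  by have [l hl] := geometric_cauchy_cvg (fun n => Hn n t tI); exists l.
have {lim} [x Hx] := choice lim.
have {}Hx n t : 0 <= t <= 1 -> `|x t - x_ n t| <= 2 * M / 2 ^+ n by move=> /Hx; exact.
have cX : cont01 x by apply: cont01_geometric_lim cx Hx.
(* To identify the limit, solve the linear problem with right-hand side built from [x] and show that
   its solution [z] equals [x], by comparing [z] with the iterates in the sup norm. Convergence of
   second derivatives never enters. *)
exists x; have [z hz] := D2_exists (L2D Ly (L2Z (tau + d) (LG _ cX))).
apply: (D2_ext _ hz) => t tI; apply/eqP; rewrite -subr_eq0 -normr_le0.
apply: (@geometric_le0 _ _ (C * (L * (2 * M)) + 2 * M)) => n.
(* Here [k] is the whole difference of the right-hand sides, so [EB] is applied with zero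
   remainder. *)
pose k := fadd (fscale d (fsub (G x) (G (x_ n)))) (fscale tau (fsub (G x) (G (x_ n.+1)))).
have Lk : L2 k by apply: L2D; apply/L2Z/L2B; exact: LG.
have M0 : 0 <= 2 * M / 2 ^+ n by rewrite divr_ge0 ?exprn_ge0// mulr_ge0// addr_ge0// ltW.
have eM : 2 * M / 2 ^+ n.+1 <= 2 * M / 2 ^+ n.
  by rewrite exprS invfM mulrCA ler_piMl// invf_le1 ?ler1n.
have kM : L2norm k <= L * (2 * M / 2 ^+ n).
  apply: L2norm_sup => [|s sI]; first exact: L2_meas.
  apply: (@le_trans _ _ (d * (L * (2 * M / 2 ^+ n)) + tau * (L * (2 * M / 2 ^+ n)))); last first.
    have X0 : 0 <= L * (2 * M / 2 ^+ n) by exact: mulr_ge0.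
    by rewrite -mulrDl ler_piMl // addrC.
  rewrite /k /fadd /fscale /fsub /G; apply: le_trans (ler_normD _ _) _.
  rewrite !normrM (ger0_norm d0) (ger0_norm tau0).
  by apply: lerD; rewrite ler_wpM2l//; apply: le_trans (gLip _ _ sI) _; rewrite ler_wpM2l//;
    [exact: Hx|exact: le_trans (Hx _ _ sI) eM].
have h := EB _ _ k (D2B hz (hx n)) Lk.
have {h} h : `|z t - x_ n.+1 t| <= C * L2norm k.
  apply: h tI => s sI; rewrite [X in _ <= X](_ : _ = 0).
    by rewrite oppr_le0 mulr_ge0// sqr_ge0.
  by rewrite /k /fadd /fscale /fsub; ring.
have -> : z t - x t = (z t - x_ n.+1 t) + (x_ n.+1 t - x t) by ring.
apply: le_trans (ler_normD _ _) _; rewrite mulrDl; apply: lerD.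
  have -> : C * (L * (2 * M)) / 2 ^+ n = C * (L * (2 * M / 2 ^+ n)) by rewrite !mulrA.
  by apply: le_trans h _; rewrite ler_wpM2l// ltW.
by rewrite distrC; exact: le_trans (Hx _ _ tI) eM.
Qed.

(** [L] affects only the number of continuation steps, while [C] comes from [c] alone and is the
    same for all of them. *)
Lemma solver y : L2 y -> exists x, D2 x (fadd y (fun t => g t (x t))).
Proof.
have [C C0 EB] := energy_bound c0 cpi.
(* [N] equal steps of length [1 / N], with [N > 2 C L] for the contraction; the successor makes [N]
   positive. *)
pose N := (Num.bound (C * L * 2)).+1.
pose d : R := N%:R^-1.
have N0 : 0 < N%:R :> R by rewrite ltr0n.
have d0 : 0 <= d by rewrite invr_ge0 ltW.
have CdL : C * (d * L) <= 2^-1.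
  have h : C * L * 2 <= N%:R.
    apply: ltW; apply: lt_trans (archi_boundP _) _; first by rewrite !mulr_ge0// ltW.
    by rewrite ltr_nat.
  by rewrite mulrCA /d mulrC ler_pdivrMr//; lra.
have P j : (j <= N)%N -> forall z, L2 z -> exists x, D2 x (fadd z (fscale (j%:R * d) (G x))).
  elim: j => [_ z Lz|j IH jN].
    have [x hx] := D2_exists Lz; exists x; congr (D2 _ _): hx.
    by apply/funext => t; rewrite /fadd /fscale !mul0r addr0.
  rewrite -addn1 natrD mulrDl mul1r; apply: (solver_step C0 EB) => //.
  - by rewrite mulr_ge0.
  - by rewrite -[X in _ + X <= _]mul1r -mulrDl natr1 ler_pdivrMr// mul1r ler_nat.
  - exact: IH (ltnW jN).
move=> Ly; have [x hx] := P N (leqnn N) y Ly; exists x; congr (D2 _ _): hx.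
by apply/funext => t; rewrite /fadd /fscale /d divff ?gt_eqF// mul1r.
Qed.

End Solver.

(** * The nonlinearity f *)

Section Strip.
Variable R : realType.
Implicit Types h : R -> R -> R.

Definition strip_cont h :=
  {within [set p : R * R | 0 <= p.1 <= 1], continuous (fun p : R * R => h p.1 p.2)}.

Lemma strip_contP h : strip_cont h -> forall t a e, 0 <= t <= 1 -> 0 < e ->
  exists2 d, 0 < d & forall s b, 0 <= s <= 1 -> `|s - t| < d -> `|b - a| < d ->
    `|h s b - h t a| <= e.
Proof.
rewrite /strip_cont subspace_continuousP => H t a e tI e0.
have /cvgrPdist_le/(_ e e0) := H (t, a) tI.
rewrite near_withinE => /nbhs_ballP[d /= d0 Hd]; exists d => // s b sI st ba.
by rewrite distrC; apply: (Hd (s, b)) => //; split; rewrite /ball /= distrC.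
Qed.

Lemma strip_cont_comp h x : strip_cont h -> cont01 x -> cont01 (fun t => h t (x t)).
Proof.
move=> ch /cont01P cx; apply/cont01P => t tI e e0.
have [d d0 Hd] := strip_contP ch (x t) tI e0.
have d20 : 0 < d / 2 by rewrite divr_gt0.
have [d' d'0 Hd'] := cx t tI _ d20.
exists (Num.min d d'); first by rewrite lt_min d0.
move=> s sI; rewrite lt_min => /andP[sd sd']; apply: Hd => //.
by rewrite (le_lt_trans (Hd' _ sI sd'))//; lra.
Qed.

Let rect (M : R) : set (R * R) := `[0, 1] `*` `[- M, M].

Let rect_compact M : compact (rect M).
Proof. by apply: compact_setX; exact: segment_compact. Qed.

Lemma strip_cont_bounded h M : strip_cont h ->
  exists2 N, 0 < N & forall t a, 0 <= t <= 1 -> `|a| <= M -> `|h t a| <= N.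
Proof.
move=> ch.
have cK : {within rect M, continuous (fun p : R * R => h p.1 p.2)}.
  by apply: continuous_subspaceW ch => p [/= + _]; rewrite in_itv.
have [N [_ HN]] := compact_bounded (continuous_compact cK (@rect_compact M)).
exists (Num.max N 0 + 1); first by rewrite ltr_wpDl// le_max lexx orbT.
move=> t a tI aM; apply: (HN (Num.max N 0 + 1)); first by rewrite ltr_pwDr// le_max lexx.
by exists (t, a) => //; split; rewrite /= in_itv //= -ler_norml.
Qed.

(** Only [a] ranges over a compact set and [b] may leave it. Compactness is therefore applied to the
    property that the estimate holds for all [b] near [a], instead of to uniform continuity on the
    rectangle. *)
Lemma strip_cont_unif h M e : strip_cont h -> 0 < e ->
  exists2 d, 0 < d & forall t a b, 0 <= t <= 1 -> `|a| <= M -> `|b - a| < d ->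
    `|h t b - h t a| <= e.
Proof.
move=> ch e0.
have cov := (near_covering_withinP _).2 ((compact_near_coveringP _).1 (@rect_compact M)).
have : \forall d \near (0 : R)^'+,
    rect M `<=` (fun p => forall b, `|b - p.2| < d -> `|h p.1 b - h p.1 p.2| <= e).
  apply: cov.
  move=> [t a] [/= tI aI]; move: tI; rewrite in_itv /= => tI.
  have e20 : 0 < e / 2 by rewrite divr_gt0.
  have [d d0 Hd] := strip_contP ch a tI e20.
  have d20 : 0 < d / 2 by rewrite divr_gt0.
  exists ([set p : R * R | `|p.1 - t| < d / 2 /\ `|p.2 - a| < d / 2], [set r | r < d / 2]).
    split => /=; last exact: nbhs_right_lt.
    by apply/nbhs_ballP; exists (d / 2) => // -[s b] [/=]; rewrite /ball /= !(distrC t) (distrC a).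
  move=> [[t' a'] r] [/= [tt aa] rd] [/= + a'I] b br; rewrite in_itv /= => t'I.
  have h1 : `|h t' b - h t a| <= e / 2.
    apply: Hd => //; first by lra.
    have -> : b - a = (b - a') + (a' - a) by ring.
    by rewrite (le_lt_trans (ler_normD _ _))//; lra.
  have h2 : `|h t' a' - h t a| <= e / 2 by apply: Hd => //; lra.
  have -> : h t' b - h t' a' = (h t' b - h t a) - (h t' a' - h t a) by ring.
  by rewrite (le_trans (ler_normB _ _))//; lra.
move=> [d /= d0 Hd]; exists (d / 2); first by rewrite divr_gt0.
move=> t a b tI aM ba; apply: (Hd (d / 2) _ _ (t, a)) => //=.
- by rewrite /ball /= sub0r normrN ger0_norm; lra.
- lra.
- by split; rewrite /= in_itv //= -ler_norml.
Qed.

End Strip.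

(** * Mean value estimates, truncation, and solvability of the linearized and nonlinear equations *)

Section Nonlinearity.
Variable R : realType.
Variables f fx : R -> R -> R.
Hypothesis f_cont : strip_cont f.
Hypothesis f_deriv : forall t x : R, 0 <= t <= 1 -> is_derive x 1 (f t) (fx t x).
Hypothesis fx_cont : strip_cont fx.
Variable c : R.
Hypothesis c0 : 0 <= c.
Hypothesis cpi : c < pi ^+ 2.
Hypothesis fx_ge : forall t x : R, 0 <= t <= 1 -> - c <= fx t x.

(** Two locations of [z] are recorded: the bound by [M] serves the Lipschitz estimate, the distance
    to [a] serves the Taylor estimate. *)
Lemma f_MVT t a b M : 0 <= t <= 1 -> `|a| <= M -> `|b| <= M ->
  exists z, [/\ `|z| <= M, `|z - a| <= `|b - a| & f t b - f t a = fx t z * (b - a)].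
Proof.
move=> tI.
have mvt a' b' : a' <= b' -> exists2 z, a' <= z <= b' & f t b' - f t a' = fx t z * (b' - a').
  move=> ab; have [z zI e] : exists2 z, z \in `[a', b']%R & f t b' - f t a' = fx t z * (b' - a').
    apply: MVT_segment => //; first by move=> z _; exact: f_deriv.
    apply: continuous_subspaceT => z; have [dz _] := f_deriv z tI.
    exact/differentiable_continuous/derivable1_diffP.
  by exists z.
rewrite !ler_norml => /andP[a1 a2] /andP[b1 b2].
have [ab|/ltW ba] := leP a b.
  have [z /andP[az zb] e] := mvt _ _ ab; exists z; split => //.
    by rewrite ler_norml; lra.
  by rewrite !ger0_norm ?subr_ge0// lerD2r.
have [z /andP[bz za] e] := mvt _ _ ba; exists z; split.
- by rewrite ler_norml; lra.
- by rewrite distrC (distrC b) !ger0_norm ?subr_ge0// lerD2l lerN2.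
- by rewrite -opprB e -mulrN opprB.
Qed.

Lemma f_monotone t a b : 0 <= t <= 1 -> - (c * (a - b) ^+ 2) <= (f t a - f t b) * (a - b).
Proof.
move=> tI; have [||z [_ _ ->]] := @f_MVT t b a (Num.max `|a| `|b|) tI.
- by rewrite le_max lexx orbT.
- by rewrite le_max lexx.
by rewrite -mulrA -expr2 -mulNr ler_wpM2r ?sqr_ge0// fx_ge.
Qed.

Lemma f_lipschitz M : exists2 L, 0 < L & forall t a b, 0 <= t <= 1 ->
  `|a| <= M -> `|b| <= M -> `|f t a - f t b| <= L * `|a - b|.
Proof.
have [L L0 HL] := strip_cont_bounded M fx_cont; exists L => // t a b tI aM bM.
have [z [zM _ ->]] := f_MVT tI bM aM.
by rewrite normrM ler_wpM2r// HL.
Qed.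

Lemma f_taylor M e : 0 < e -> exists2 d, 0 < d & forall t a h, 0 <= t <= 1 ->
  `|a| <= M -> `|h| < d -> `|f t (a + h) - f t a - fx t a * h| <= e * `|h|.
Proof.
move=> e0; have [d d0 Hd] := strip_cont_unif M fx_cont e0; exists d => // t a h tI aM hd.
have [||z [_ za ->]] := @f_MVT t a (a + h) (Num.max `|a| `|a + h|) tI.
- by rewrite le_max lexx.
- by rewrite le_max lexx orbT.
move: za; rewrite addrAC subrr add0r => za.
by rewrite -mulrBl normrM ler_wpM2r// Hd// (le_lt_trans za).
Qed.

Lemma ge0_mul_of_lower (q a : R) : - c <= q -> - (c * a ^+ 2) <= q * a * a.
Proof. by move=> qc; rewrite -mulrA -expr2 -mulNr ler_wpM2r ?sqr_ge0. Qed.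

Lemma linear_exists x k : cont01 x -> L2 k ->
  exists h, D2 h (fadd k (fun t => fx t (x t) * h t)).
Proof.
move=> cx Lk; have cq := strip_cont_comp fx_cont cx.
have [K K0 HK] := cont01_bounded cq.
apply: (@solver R (fun t a => fx t (x t) * a) c K) => //.
- exact: ltW.
- move=> h /cont01P ch; apply/cont01P => t tI e e0.
  have [N N0 HN] := cont01_bounded ((cont01P _).2 ch).
  have p0 : 0 < e / (2 * K) by rewrite divr_gt0// mulr_gt0.
  have r0 : 0 < e / (2 * N) by rewrite divr_gt0// mulr_gt0.
  have [d1 d10 H1] := ch t tI _ p0.
  have [d2 d20 H2] := (cont01P _).1 cq t tI _ r0.
  exists (Num.min d1 d2); first by rewrite lt_min d10.
  move=> s sI; rewrite lt_min => /andP[s1 s2].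
  have -> : fx s (x s) * h s - fx t (x t) * h t =
     fx s (x s) * (h s - h t) + (fx s (x s) - fx t (x t)) * h t by ring.
  rewrite (le_trans (ler_normD _ _))// !normrM.
  have a1 : `|fx s (x s)| * `|h s - h t| <= K * (e / (2 * K)) by apply: ler_pM => //; [exact: HK|exact: H1].
  have a2 : `|fx s (x s) - fx t (x t)| * `|h t| <= e / (2 * N) * N by apply: ler_pM => //; [exact: H2|exact: HN].
  have b1 : K * (e / (2 * K)) = e / 2 by field; rewrite gt_eqF.
  have b2 : e / (2 * N) * N = e / 2 by field; rewrite gt_eqF.
  lra.
- by move=> t a b tI; rewrite -mulrBr normrM ler_wpM2r// HK.
- by move=> t a b tI; rewrite -mulrBr; apply: ge0_mul_of_lower; exact: fx_ge.
Qed.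

Let clamp (M a : R) := Num.max (- M) (Num.min a M).

Let clamp_id M a : `|a| <= M -> clamp M a = a.
Proof. by rewrite ler_norml => /andP[aM Ma]; rewrite /clamp min_l// max_r. Qed.

Let clampP M a b : 0 <= M -> b <= a ->
  [/\ `|clamp M a| <= M, `|clamp M b| <= M & 0 <= clamp M a - clamp M b <= a - b].
Proof.
move=> M0 ba; rewrite !ler_norml /clamp.
by split; case: (leP a M) => ?; case: (leP b M) => ?; rewrite ?(@max_r _ _ (- M) M);
  try (case: (leP (- M) a) => ?); try (case: (leP (- M) b) => ?); try (apply/andP; split); lra.
Qed.

(** [clamp] is nondecreasing and 1-Lipschitz. For [b <= a], with [d] the increment of the clamped
    values and [D = a - b], one has [0 <= d <= D], so the product is [q d D >= - c d D >= - c D^2],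
    the last step by [c >= 0]. *)
Let clamp_f_bounds M L t a b : 0 <= M -> 0 <= L -> 0 <= t <= 1 ->
  (forall a b, `|a| <= M -> `|b| <= M -> `|f t a - f t b| <= L * `|a - b|) ->
  `|f t (clamp M a) - f t (clamp M b)| <= L * `|a - b| /\
  - (c * (a - b) ^+ 2) <= (f t (clamp M a) - f t (clamp M b)) * (a - b).
Proof.
move=> M0 L0 tI HL; wlog ba : a b / b <= a.
  move=> H; have [ab|/ltW ba] := leP b a; first exact: H.
  have [h1 h2] := H b a ba; rewrite distrC (distrC a); split => //.
  by move: h2; congr (_ <= _); ring.
have [aM bM /andP[d0 dab]] := clampP M0 ba.
have ab0 : 0 <= a - b by rewrite subr_ge0.
split; first by apply: le_trans (HL _ _ aM bM) _; rewrite !ger0_norm// ler_wpM2l.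
have [z [_ _ ->]] := f_MVT tI bM aM.
have := fx_ge z tI; move: (fx t z) (clamp M a - clamp M b) (a - b) d0 dab ab0.
move=> q d D d0 dD D0 cq; apply: le_trans (_ : - c * (d * D) <= _).
  by rewrite -mulNr ler_wnM2l ?oppr_le0// expr2 ler_wpM2r.
by rewrite -(mulrA q) ler_wpM2r// mulr_ge0.
Qed.

Lemma solution_exists y : L2 y -> exists x, D2 x (fadd y (fun t => f t (x t))).
Proof.
move=> Ly; have [C C0 EB] := energy_bound c0 cpi.
have L0 : L2 (fun t => f t 0).
  by apply: cont01_L2; apply: (@strip_cont_comp _ f (fun=> 0)) => //; exact/AC01_cont/AC01_cst.
pose k := fadd y (fun t => f t 0); have Lk : L2 k by exact: L2D.
(* There is no circularity: [C] depends on [c] only, and truncation preserves [c] and the value at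
   0, so the truncated equation obeys the same a priori bound [M]. Its solution thus stays where
   [clamp] is the identity. *)
pose M := C * L2norm k; have M0 : 0 <= M by rewrite mulr_ge0 ?L2norm_ge0// ltW.
have [L /ltW Lge0 HL] := f_lipschitz M.
have lip (t a b : R) (tI : 0 <= t <= 1) :=
  @clamp_f_bounds M L t a b M0 Lge0 tI (fun a b => HL t a b tI).
have [x hx] : exists x, D2 x (fadd y (fun t => f t (clamp M (x t)))).
  apply: (@solver R (fun t a => f t (clamp M a)) c L) => //.
  - move=> x /cont01P cx; apply: (@strip_cont_comp _ f (fun t => clamp M (x t))) => //.
    apply/cont01P => t tI e e0; have [d d0 Hd] := cx t tI e e0.
    exists d => // s sI st; apply: le_trans (Hd s sI st).
    have [xx|/ltW xx] := leP (x s) (x t); have [_ _ /andP[? ?]] := clampP M0 xx;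
      have ? := xx; move: xx; rewrite -subr_ge0 => ?.
      by rewrite distrC (distrC (x s)) !ger0_norm.
    by rewrite !ger0_norm.
  - by move=> t a b /(lip t a b)[].
  - by move=> t a b /(lip t a b)[].
exists x; apply: (D2_eq _ hx) => t tI; rewrite /fadd clamp_id//.
apply: EB hx Lk _ t tI => t tI.
have [_] := lip t (x t) 0 tI; rewrite subr0 (@clamp_id M 0) ?normr0//.
by congr (_ <= _ * _); rewrite /k /fadd; ring.
Qed.

End Nonlinearity.

(** * Inverses of C^1 maps between seminormed spaces *)

Section SeminormedSpace.
Variable R : realType.
Implicit Types (u v w : R -> R).

Definition seminormed (P : (R -> R) -> Prop) (N : (R -> R) -> R) :=
  [/\ forall u v, P u -> P v -> P (fadd u v),
      forall a u, P u -> P (fscale a u),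
      forall u v, P u -> P v -> N (fadd u v) <= N u + N v &
      forall a u, P u -> N (fscale a u) = `|a| * N u].

Variables (P : (R -> R) -> Prop) (N : (R -> R) -> R).
Hypothesis SP : seminormed P N.

Lemma seminormed_D u v : P u -> P v -> P (fadd u v). Proof. by case: SP => h _ _ _; exact: h. Qed.

Lemma seminormed_Z a u : P u -> P (fscale a u). Proof. by case: SP => _ h _ _; exact: h. Qed.

Lemma seminormed_B u v : P u -> P v -> P (fsub u v).
Proof. by move=> pu pv; rewrite fsubE; apply: seminormed_D => //; exact: seminormed_Z. Qed.

Lemma seminorm_D u v : P u -> P v -> N (fadd u v) <= N u + N v.
Proof. by case: SP => _ _ h _; exact: h. Qed.

Lemma seminorm_Z a u : P u -> N (fscale a u) = `|a| * N u.
Proof. by case: SP => _ _ _ h; exact: h. Qed.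

Lemma seminorm_ge0 u : P u -> 0 <= N u.
Proof.
move=> pu; have := seminorm_D pu (seminormed_Z (-1) pu).
rewrite seminorm_Z// normrN1 mul1r.
have -> : fadd u (fscale (-1) u) = fscale 0 u.
  by apply/funext => t; rewrite /fadd /fscale mulN1r subrr mul0r.
by rewrite seminorm_Z// normr0 mul0r; lra.
Qed.

Lemma seminorm_B u v : P u -> P v -> N (fsub u v) <= N u + N v.
Proof.
move=> pu pv; rewrite fsubE; apply: le_trans (seminorm_D pu (seminormed_Z _ pv)) _.
by rewrite seminorm_Z// normrN1 mul1r.
Qed.

(** Equality in the quotient by the null space of the seminorm; the quotient itself is never
    formed. *)
Definition eqv u v := N (fsub u v) = 0.

Lemma eqv_intro u v : P u -> P v -> N (fsub u v) <= 0 -> eqv u v.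
Proof. by move=> pu pv h; apply/eqP; rewrite eq_le h seminorm_ge0//; exact: seminormed_B. Qed.

Lemma eqv_refl u : P u -> eqv u u.
Proof.
move=> pu; rewrite /eqv (_ : fsub u u = fscale 0 u) ?seminorm_Z ?normr0 ?mul0r//.
by apply/funext => t; rewrite /fsub /fscale subrr mul0r.
Qed.

Lemma eqv_sym u v : P u -> P v -> eqv u v -> eqv v u.
Proof.
move=> pu pv; rewrite /eqv (_ : fsub v u = fscale (-1) (fsub u v)).
  by rewrite seminorm_Z => [->|]; [rewrite mulr0|exact: seminormed_B].
by apply/funext => t; rewrite /fsub /fscale mulN1r opprB.
Qed.

Lemma eqv_trans v u w : P u -> P v -> P w -> eqv u v -> eqv v w -> eqv u w.
Proof.
move=> pu pv pw uv vw; apply: eqv_intro => //.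
rewrite (_ : fsub u w = fadd (fsub u v) (fsub v w)).
  apply: le_trans (seminorm_D (seminormed_B pu pv) (seminormed_B pv pw)) _.
  by rewrite uv vw addr0.
by apply/funext => t; rewrite /fadd /fsub addrA subrK.
Qed.

Lemma eqv_D u v u' v' : P u -> P v -> P u' -> P v' -> eqv u u' -> eqv v v' ->
  eqv (fadd u v) (fadd u' v').
Proof.
move=> pu pv pu' pv' uu vv.
apply: eqv_intro; [exact: seminormed_D|exact: seminormed_D|].
rewrite (_ : fsub _ _ = fadd (fsub u u') (fsub v v')).
  apply: le_trans (seminorm_D (seminormed_B pu pu') (seminormed_B pv pv')) _.
  by rewrite uu vv addr0.
by apply/funext => t; rewrite /fadd /fsub; ring.
Qed.

Lemma eqv_Z a u v : P u -> P v -> eqv u v -> eqv (fscale a u) (fscale a v).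
Proof.
move=> pu pv uv; rewrite /eqv (_ : fsub _ _ = fscale a (fsub u v)).
  by rewrite seminorm_Z ?uv ?mulr0//; exact: seminormed_B.
by apply/funext => t; rewrite /fscale /fsub mulrBr.
Qed.

Lemma eqv_B u v u' v' : P u -> P v -> P u' -> P v' -> eqv u u' -> eqv v v' ->
  eqv (fsub u v) (fsub u' v').
Proof.
move=> pu pv pu' pv' uu vv; rewrite !fsubE.
by apply: eqv_D => //; try exact: seminormed_Z; exact: eqv_Z.
Qed.

Lemma eqv_norm u v : P u -> P v -> eqv u v -> N u = N v.
Proof.
have le u' v' : P u' -> P v' -> eqv u' v' -> N u' <= N v'.
  move=> pu pv uv; have := seminorm_D pv (seminormed_B pu pv).
  rewrite uv addr0 (_ : fadd _ _ = u') //.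
  by apply/funext => t; rewrite /fadd /fsub subrKC.
by move=> pu pv uv; apply/eqP; rewrite eq_le !le//; exact: eqv_sym.
Qed.

End SeminormedSpace.

(** * C^1 regularity of an inverse from a lower bound on [DF] and a local Lipschitz bound on [G] *)

Section InverseC1.
Variable R : realType.
Variables (PX : (R -> R) -> Prop) (NX : (R -> R) -> R).
Variables (PY : (R -> R) -> Prop) (NY : (R -> R) -> R).
Hypothesis SX : seminormed PX NX.
Hypothesis SY : seminormed PY NY.

Lemma bounded_linear_sub L u v : bounded_linear PX NX PY NY L -> PX u -> PX v ->
  eqv NY (L (fsub u v)) (fsub (L u) (L v)).
Proof.
move=> [LP [LD [LZ _]]] pu pv; rewrite !fsubE.
have pv' := seminormed_Z SX (-1) pv.
apply: (eqv_trans SY (v := fadd (L u) (L (fscale (-1) v)))).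
- by apply/LP/(seminormed_D SX).
- by apply: (seminormed_D SY); exact: LP.
- by apply: (seminormed_D SY); [exact: LP|apply: (seminormed_Z SY); exact: LP].
- exact: LD.
- apply: (eqv_D SY); try exact: LP; try exact: (eqv_refl SY (LP _ _)).
    by apply: (seminormed_Z SY); exact: LP.
  exact: LZ.
Qed.

Variables (F G : (R -> R) -> R -> R) (DF DG : (R -> R) -> (R -> R) -> R -> R).
Hypothesis FP : forall x, PX x -> PY (F x).
Hypothesis F_deriv : forall x, PX x -> frechet_deriv PX NX PY NY F x (DF x).
Hypothesis DF_cont : forall x, PX x -> forall eps : R, 0 < eps ->
  exists2 delta : R, 0 < delta & forall y, PX y -> NX (fsub y x) < delta ->
    forall h, PX h -> NY (fsub (DF y h) (DF x h)) <= eps * NX h.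
Hypothesis GP : forall y, PY y -> PX (G y).
Hypothesis FG : forall y, PY y -> eqv NY (F (G y)) y.
Hypothesis DGP : forall y k, PY y -> PY k -> PX (DG y k).
Hypothesis DF_DG : forall y k, PY y -> PY k -> eqv NY (DF (G y) (DG y k)) k.
Hypothesis DF_inj : forall x, PX x ->
  exists2 C, 0 < C & forall h, PX h -> NX h <= C * NY (DF x h).
Hypothesis G_lip : forall y, PY y -> exists2 C, 0 < C & exists2 delta, 0 < delta &
  forall k, PY k -> NY k < delta -> NX (fsub (G (fadd y k)) (G y)) <= C * NY k.

Let DFl x : PX x -> bounded_linear PX NX PY NY (DF x).
Proof. by move=> /F_deriv[]. Qed.

Let DFP x h : PX x -> PX h -> PY (DF x h).
Proof. by move=> px ph; have [h1 _] := DFl px; exact: h1. Qed.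

Let DG_bound y : PY y -> exists2 C, 0 < C & forall k, PY k -> NX (DG y k) <= C * NY k.
Proof.
move=> py; have px := GP py; have [C C0 HC] := DF_inj px; exists C => // k pk.
apply: le_trans (HC _ (DGP py pk)) _.
by rewrite (eqv_norm SY _ _ (DF_DG py pk))//; apply: DFP => //; exact: DGP.
Qed.

Let DG_eqv y h k : PY y -> PX h -> PY k -> eqv NY (DF (G y) h) k -> eqv NX (DG y k) h.
Proof.
move=> py ph pk hk; have px := GP py; have [C C0 HC] := DF_inj px.
have pd := DGP py pk; apply: (eqv_intro SX) => //.
apply: le_trans (HC _ (seminormed_B SX pd ph)) _.
have pA := DFP px pd; have pB := DFP px ph.
rewrite (eqv_norm SY _ _ (bounded_linear_sub (DFl px) pd ph)).
- by rewrite (eqv_trans SY pA pk pB (DF_DG py pk) (eqv_sym SY pB pk hk)) mulr0.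
- by apply: DFP => //; exact: (seminormed_B SX).
- exact: (seminormed_B SY).
Qed.

(** Linearity is inherited by uniqueness: both sides have the same image under [DF (G y)], which is
    injective up to [eqv]. *)
Let DG_linear y : PY y -> bounded_linear PY NY PX NX (DG y).
Proof.
move=> py; have px := GP py; have [_ [LD [LZ _]]] := DFl px.
split; first by move=> u; exact: DGP.
split; [|split].
- move=> u v pu pv; have du := DGP py pu; have dv := DGP py pv.
  apply: DG_eqv => //; [exact: (seminormed_D SX)|exact: (seminormed_D SY)|].
  have pA := DFP px du; have pB := DFP px dv.
  apply: (eqv_trans SY _ _ _ (LD _ _ du dv)).
  + by apply: DFP => //; exact: (seminormed_D SX).
  + exact: (seminormed_D SY).
  + exact: (seminormed_D SY).
  + by apply: (eqv_D SY) => //; exact: DF_DG.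
- move=> a u pu; have du := DGP py pu; have pA := DFP px du.
  apply: DG_eqv => //; [exact: (seminormed_Z SX)|exact: (seminormed_Z SY)|].
  apply: (eqv_trans SY _ _ _ (LZ a _ du)).
  + by apply: DFP => //; exact: (seminormed_Z SX).
  + exact: (seminormed_Z SY).
  + exact: (seminormed_Z SY).
  + by apply: (eqv_Z SY) => //; exact: DF_DG.
- by have [C _ HC] := DG_bound py; exists C.
Qed.

(** With [d = G (y + k) - G y], applying [DF (G y)] to [d - DG y k] gives [DF d - k]. As [k] is the
    increment of [F] from [G y] to [G y + d], this is minus the Taylor remainder of [F] at [d]. *)
Let G_deriv y : PY y -> frechet_deriv PY NY PX NX G y (DG y).
Proof.
move=> py; split; first exact: DG_linear.
move=> eps eps0; have px := GP py.
have [C C0 HC] := DF_inj px; have [K K0 [d1 d10 HK]] := G_lip py.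
(* [C] is lost in inverting [DF], and [K] in bounding [d] by [k]. *)
have eta0 : 0 < eps / (C * K) by rewrite divr_gt0// mulr_gt0.
have [_ /(_ _ eta0)[d2 d20 HF]] := F_deriv px.
exists (Num.min d1 (d2 / K)); first by rewrite lt_min d10 divr_gt0.
move=> k pk; rewrite lt_min => /andP[k1 k2].
pose d := fsub (G (fadd y k)) (G y).
have pyk : PY (fadd y k) by exact: (seminormed_D SY).
have pxk : PX (G (fadd y k)) by exact: GP.
have pd : PX d by exact: (seminormed_B SX).
have dK : NX d <= K * NY k by exact: HK.
have d2d : NX d < d2 by rewrite (le_lt_trans dK)// mulrC -ltr_pdivlMr.
have := HF d pd d2d.
have -> : fadd (G y) d = G (fadd y k) by apply/funext => t; rewrite /fadd /d /fsub subrKC.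
move=> Hd; have ph := DGP py pk; have pLd := DFP px pd; have pLh := DFP px ph.
have pF1 := FP pxk; have pF0 := FP px.
apply: le_trans (HC _ (seminormed_B SX pd ph)) _.
rewrite (eqv_norm SY _ _ (bounded_linear_sub (DFl px) pd ph)); first last.
- exact: (seminormed_B SY).
- by apply: DFP => //; exact: (seminormed_B SX).
have e1 : eqv NY (fsub (F (G (fadd y k))) (F (G y))) (DF (G y) (DG y k)).
  apply: (eqv_trans SY (v := k)) => //; first exact: (seminormed_B SY).
    have := eqv_B SY pF1 pF0 pyk py (FG pyk) (FG py).
    by rewrite (_ : fsub (fadd y k) y = k)//; apply/funext => t; rewrite /fsub /fadd addrAC subrr add0r.
  by apply: (eqv_sym SY) => //; exact: DF_DG.
have pF10 : PY (fsub (F (G (fadd y k))) (F (G y))) by exact: (seminormed_B SY).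
have e2 := eqv_B SY pF10 pLd pLh pLd e1 (eqv_refl SY pLd).
have e3 : NY (fsub (DF (G y) d) (DF (G y) (DG y k))) = NY (fsub (DF (G y) (DG y k)) (DF (G y) d)).
  rewrite (_ : fsub (DF (G y) d) _ = fscale (-1) (fsub (DF (G y) (DG y k)) (DF (G y) d))).
    by rewrite (seminorm_Z SY) ?normrN1 ?mul1r//; exact: (seminormed_B SY).
  by apply/funext => t; rewrite /fsub /fscale mulN1r opprB.
rewrite e3 -(eqv_norm SY _ _ e2); [|exact: (seminormed_B SY)|exact: (seminormed_B SY)].
apply: le_trans (_ : C * (eps / (C * K) * (K * NY k)) <= _).
  by rewrite (ler_pM2l C0) (le_trans Hd)// ler_wpM2l// ltW// divr_gt0// mulr_gt0.
rewrite le_eqVlt; apply/orP; left; apply/eqP; field.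
by rewrite !gt_eqF.
Qed.

(** Up to [eqv], [DF (G y)] maps [DG z k - DG y k] to [(DF (G y) - DF (G z)) (DG z k)], which is
    small by continuity of [DF]. *)
Let DG_cont y : PY y -> forall eps : R, 0 < eps -> exists2 delta : R, 0 < delta &
  forall z, PY z -> NY (fsub z y) < delta ->
    forall k, PY k -> NX (fsub (DG z k) (DG y k)) <= eps * NY k.
Proof.
move=> py eps eps0; have px := GP py.
have [C C0 HC] := DF_inj px; have [K K0 [d1 d10 HK]] := G_lip py.
(* [DF_inj] gives a constant at each point separately, so [DG z] has no bound uniform in [z] yet.
   The first entry gives [C * eta <= 1/2], which absorbs [DG z k] and yields [Z <= 2 * Y]; the
   second makes the final constant at most [eps]. *)
pose eta := Num.min (2 * C)^-1 (eps / (2 * C ^+ 2)).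
have eta0 : 0 < eta.
  by rewrite lt_min invr_gt0 divr_gt0 ?mulr_gt0// exprn_gt0.
have [d2 d20 HF] := DF_cont px eta0.
exists (Num.min d1 (d2 / K)); first by rewrite lt_min d10 divr_gt0.
move=> z pz; rewrite lt_min => /andP[k1 k2] k pk.
have pxz := GP pz.
have pzy : PY (fsub z y) by exact: (seminormed_B SY).
have near : NX (fsub (G z) (G y)) < d2.
  have := HK _ pzy k1.
  have -> : fadd y (fsub z y) = z by apply/funext => t; rewrite /fadd /fsub subrKC.
  by move=> h; rewrite (le_lt_trans h)// mulrC -ltr_pdivlMr.
have ph := DGP py pk; have ph' := DGP pz pk.
have pLh := DFP px ph; have pLh' := DFP px ph'; have pL'h' := DFP pxz ph'.
have H := HF _ pxz near _ ph'.
have pB := seminormed_B SX ph' ph.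
have Hd : NX (fsub (DG z k) (DG y k)) <= C * (eta * NX (DG z k)).
  apply: le_trans (HC _ pB) _; rewrite (ler_pM2l C0).
  rewrite (eqv_norm SY _ _ (bounded_linear_sub (DFl px) ph' ph)); first last.
  - exact: (seminormed_B SY).
  - exact: DFP.
  have e1 : eqv NY (DF (G y) (DG y k)) (DF (G z) (DG z k)).
    apply: (eqv_trans SY (v := k)) => //; first exact: DF_DG.
    by apply: (eqv_sym SY) => //; exact: DF_DG.
  have e2 := eqv_B SY pLh' pLh pLh' pL'h' (eqv_refl SY pLh') e1.
  rewrite (eqv_norm SY _ _ e2); [|exact: (seminormed_B SY)|exact: (seminormed_B SY)].
  apply: le_trans H; rewrite le_eqVlt; apply/orP; left; apply/eqP.
  rewrite (_ : fsub (DF (G y) (DG z k)) _ = fscale (-1) (fsub (DF (G z) (DG z k)) (DF (G y) (DG z k)))).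
    by rewrite (seminorm_Z SY) ?normrN1 ?mul1r//; exact: (seminormed_B SY).
  by apply/funext => t; rewrite /fsub /fscale mulN1r opprB.
have b0 : NX (DG y k) <= C * NY k.
  apply: le_trans (HC _ ph) _; rewrite (eqv_norm SY _ _ (DF_DG py pk))//.
have tri : NX (DG z k) <= NX (fsub (DG z k) (DG y k)) + NX (DG y k).
  have := seminorm_D SX pB ph.
  by rewrite (_ : fadd _ _ = DG z k)//; apply/funext => t; rewrite /fadd /fsub subrK.
have := seminorm_ge0 SX ph'; have := seminorm_ge0 SX pB; have := seminorm_ge0 SY pk.
move: (NX (fsub _ _)) (NX (DG z k)) (NX (DG y k)) (NY k) Hd b0 tri => D Z Y k0 Hd b0 tri k00 D0 Z0.
have E1 : C * eta <= 2^-1.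
  have : eta <= (2 * C)^-1 by rewrite ge_min lexx.
  by rewrite -(ler_pM2l C0) invfM [C * (2^-1 / C)]mulrCA divff ?mulr1// gt_eqF.
have E2 : C * eta * (2 * C) <= eps.
  have : eta <= eps / (2 * C ^+ 2) by rewrite ge_min lexx orbT.
  rewrite ler_pdivlMr; last by rewrite mulr_gt0// exprn_gt0.
  by congr (_ <= _); ring.
have Z2 : Z <= 2 * Y.
  have : C * (eta * Z) <= 2^-1 * Z by rewrite mulrA ler_wpM2r.
  lra.
apply: le_trans Hd _; apply: le_trans (_ : C * eta * (2 * C) * k0 <= _); last by rewrite ler_wpM2r.
rewrite mulrA -!(mulrA (C * eta)) ler_wpM2l//; first by rewrite mulr_ge0 // ltW.
by apply: le_trans Z2 _; rewrite -mulrA ler_wpM2l.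
Qed.

Lemma inverse_C1 : C1map PY NY PX NX G.
Proof.
split; first exact: GP.
by exists DG; split; [exact: G_deriv|exact: DG_cont].
Qed.

End InverseC1.

(** * The operator T *)

Section SpaceX.
Variable R : realType.
Implicit Types (u v w x y h k : R -> R).

(** The function selected by [epsilon] comes with its own first derivative, which need not be the
    one given by membership in X. *)
Lemma inX_D2 x : inX x -> D2 x (ddot x).
Proof.
move=> [v [w [hx [hv [x0 x1]]]]].
have ex : exists w, exists v, H1_with_deriv x v /\ H1_with_deriv v w by exists w, v.
have [v' [h1 h2]] := ClassicalEpsilon.epsilon_spec (inhabits (fun _ : R => 0 : R)) _ ex.
by exists v'.
Qed.

Lemma D2_inX x w : D2 x w -> inX x.
Proof. by move=> [v [hx hv x0 x1]]; exists v, w. Qed.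

Lemma D2_ddot x w : D2 x w -> ae01 (ddot x) w.
Proof. by move=> hx; exact: D2_unique (inX_D2 (D2_inX hx)) hx. Qed.

Lemma D2_Xnorm x w : D2 x w -> Xnorm x = L2norm w.
Proof.
move=> hx; apply: (ae01_L2norm _ _ (D2_ddot hx)); last exact: L2_meas (D2_L2 hx).
exact: L2_meas (D2_L2 (inX_D2 (D2_inX hx))).
Qed.

Lemma seminormed_L2 : seminormed (@L2 R) (@L2norm R).
Proof.
by split=> *; [exact: L2D|exact: L2Z|exact: L2normD|exact: L2normZ].
Qed.

Lemma seminormed_inX : seminormed (@inX R) (@Xnorm R).
Proof.
split=> [u v /inX_D2 hu /inX_D2 hv|a u /inX_D2 hu|u v /inX_D2 hu /inX_D2 hv|a u /inX_D2 hu].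
- exact: D2_inX (D2D hu hv).
- exact: D2_inX (D2Z a hu).
- by rewrite (D2_Xnorm (D2D hu hv)); apply: L2normD; exact: D2_L2 hu || exact: D2_L2 hv.
- by rewrite (D2_Xnorm (D2Z a hu)) L2normZ//; exact: D2_L2 hu.
Qed.

(** The energy estimate with [c = 0] and [k] the second derivative itself: X embeds into the bounded
    functions. *)
Lemma inX_sup_bound : exists2 C, 0 < C & forall h, inX h ->
  forall t, 0 <= t <= 1 -> `|h t| <= C * Xnorm h.
Proof.
have pi20 : (0 : R) < pi ^+ 2 by rewrite exprn_gt0// pi_gt0.
have [C C0 EB] := energy_bound (lexx 0) pi20; exists C => // h /inX_D2 hh.
apply: (EB _ _ _ hh (D2_L2 hh)) => t _; by rewrite subrr !mul0r oppr0.
Qed.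

(** On the unit interval [x] coincides with [0 * x], so zero is also a second derivative of [x]. *)
Lemma D2_eq0 x w : D2 x w -> (forall t, 0 <= t <= 1 -> x t = 0) -> Xnorm x = 0.
Proof.
move=> hx x0; have h0 : D2 x (fscale 0 w).
  by apply: (D2_ext _ (D2Z 0 hx)) => t /x0; rewrite /fscale => ->; rewrite mulr0.
rewrite (D2_Xnorm h0) L2normZ ?normr0 ?mul0r//; exact: D2_L2 hx.
Qed.

End SpaceX.

(** * The derivative of T, its invertibility, and the inverse *)

Section TopDiffeomorphism.
Variable R : realType.
Variables f fx : R -> R -> R.
Hypothesis f_cont : strip_cont f.
Hypothesis f_deriv : forall t x : R, 0 <= t <= 1 -> is_derive x 1 (f t) (fx t x).
Hypothesis fx_cont : strip_cont fx.
Variable c : R.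
Hypothesis c0 : 0 <= c.
Hypothesis cpi : c < pi ^+ 2.
Hypothesis fx_ge : forall t x : R, 0 <= t <= 1 -> - c <= fx t x.
Implicit Types (u v w x y h k : R -> R).

Let f_L2 x : cont01 x -> L2 (fun t => f t (x t)).
Proof. by move=> cx; exact/cont01_L2/strip_cont_comp. Qed.

Let inX_cont x : inX x -> cont01 x.
Proof. by move=> /inX_D2/D2_cont. Qed.

Let mul_fx_L2 x h : cont01 x -> cont01 h -> L2 (fun t => fx t (x t) * h t).
Proof.
move=> cx ch; have cq := strip_cont_comp fx_cont cx.
have [K _ HK] := cont01_bounded cq.
by apply: L2M_bounded HK (cont01_L2 ch); exact: cont01_meas.
Qed.

Let mul_fx_norm x : cont01 x -> exists2 K, 0 < K & forall h N, cont01 h ->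
  (forall t, 0 <= t <= 1 -> `|h t| <= N) -> L2norm (fun t => fx t (x t) * h t) <= K * N.
Proof.
move=> cx; have [K K0 HK] := cont01_bounded (strip_cont_comp fx_cont cx).
exists K => // h N ch hN; apply: L2norm_sup => [|t tI].
  exact: L2_meas (mul_fx_L2 cx ch).
by rewrite normrM ler_pM// ?HK// hN.
Qed.

Lemma Top_L2 x : inX x -> L2 (Top f x).
Proof.
by move=> hx; apply: L2B (D2_L2 (inX_D2 hx)) (f_L2 (inX_cont hx)).
Qed.

Definition dTop x h : R -> R := fun t => ddot h t - fx t (x t) * h t.

Lemma dTop_L2 x h : inX x -> inX h -> L2 (dTop x h).
Proof.
move=> hx hh; apply: L2B (D2_L2 (inX_D2 hh)) (mul_fx_L2 _ _); exact: inX_cont.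
Qed.

Lemma dTop_linear x : inX x -> bounded_linear (@inX R) (@Xnorm R) (@L2 R) (@L2norm R) (dTop x).
Proof.
move=> hx; split; first by move=> u; exact: dTop_L2.
split; [|split].
- move=> u v hu hv; have huv := D2D (inX_D2 hu) (inX_D2 hv).
  apply: ae01_L2norm_sub; first exact: dTop_L2 (D2_inX huv).
    by apply: L2D; exact: dTop_L2.
  by apply: filterS (D2_ddot huv) => t e /e; rewrite /dTop /fadd => ->; ring.
- move=> a u hu; have hau := D2Z a (inX_D2 hu).
  apply: ae01_L2norm_sub; first exact: dTop_L2 (D2_inX hau).
    by apply: L2Z; exact: dTop_L2.
  by apply: filterS (D2_ddot hau) => t e /e; rewrite /dTop /fscale => ->; ring.
- have [C C0 HC] := inX_sup_bound R; have [K K0 HK] := mul_fx_norm (inX_cont hx).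
  exists (1 + K * C) => u hu.
  have Lq := mul_fx_L2 (inX_cont hx) (inX_cont hu).
  apply: le_trans (seminorm_B (seminormed_L2 R) (D2_L2 (inX_D2 hu)) Lq) _.
  rewrite mulrDl mul1r lerD2l -mulrA.
  by apply: HK; [exact: inX_cont|exact: HC].
Qed.

(** The second derivatives cancel almost everywhere, leaving minus the Taylor remainder of [f]. It
    is estimated in the sup norm, and [eps / C] compensates for the embedding constant. *)
Lemma Top_deriv x : inX x ->
  frechet_deriv (@inX R) (@Xnorm R) (@L2 R) (@L2norm R) (Top f) x (dTop x).
Proof.
move=> hx; split; first exact: dTop_linear.
move=> eps eps0; have [C C0 HC] := inX_sup_bound R.
have [M M0 HM] := cont01_bounded (inX_cont hx).
have [d d0 Hd] := f_taylor f_deriv fx_cont M (divr_gt0 eps0 C0).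
exists (d / C); first by rewrite divr_gt0.
move=> h hh hd; have hxh := D2D (inX_D2 hx) (inX_D2 hh).
have hxX := D2_inX hxh.
pose r t := f t (x t + h t) - f t (x t) - fx t (x t) * h t.
have Lr : L2 r.
  apply: L2B (mul_fx_L2 (inX_cont hx) (inX_cont hh)).
  exact: L2B (f_L2 (inX_cont hxX)) (f_L2 (inX_cont hx)).
have Ll : L2 (fsub (fsub (Top f (fadd x h)) (Top f x)) (dTop x h)).
  by apply: L2B (dTop_L2 hx hh); apply: L2B; exact: Top_L2.
rewrite (ae01_L2norm (L2_meas Ll) (L2_meas (L2Z (-1) Lr))); last first.
  apply: filterS (D2_ddot hxh) => t e /e; rewrite /fsub /Top /dTop /fadd /fscale /r => ->.
  by ring.
rewrite L2normZ// normrN1 mul1r; apply: L2norm_sup; first exact: L2_meas.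
move=> t tI; have hb := HC _ hh t tI.
apply: le_trans (Hd _ _ _ tI (HM t tI) _) _.
  by rewrite (le_lt_trans hb)// mulrC -ltr_pdivlMr.
apply: le_trans (_ : eps / C * (C * Xnorm h) <= _).
  by rewrite ler_wpM2l// ltW// divr_gt0.
by rewrite mulrA divfK// gt_eqF.
Qed.

Lemma dTop_cont x : inX x -> forall eps : R, 0 < eps ->
  exists2 delta : R, 0 < delta & forall y, inX y -> Xnorm (fsub y x) < delta ->
    forall h, inX h -> L2norm (fsub (dTop y h) (dTop x h)) <= eps * Xnorm h.
Proof.
move=> hx eps eps0; have [C C0 HC] := inX_sup_bound R.
have [M M0 HM] := cont01_bounded (inX_cont hx).
have [d d0 Hd] := strip_cont_unif M fx_cont (divr_gt0 eps0 C0).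
exists (d / C); first by rewrite divr_gt0.
move=> y hy hd h hh; apply: L2norm_sup.
  exact: L2_meas (L2B (dTop_L2 hy hh) (dTop_L2 hx hh)).
move=> t tI; have hb := HC _ hh t tI.
have db := HC _ (seminormed_B (seminormed_inX R) hy hx) t tI.
have -> : fsub (dTop y h) (dTop x h) t = - ((fx t (y t) - fx t (x t)) * h t).
  by rewrite /fsub /dTop; ring.
rewrite normrN normrM; apply: le_trans (_ : eps / C * (C * Xnorm h) <= _).
  apply: ler_pM => //; apply: Hd => //; first exact: HM.
  by rewrite (le_lt_trans db)// mulrC -ltr_pdivlMr.
by rewrite mulrA divfK// gt_eqF.
Qed.

(** The energy estimate with [k = dTop x h] bounds [h] in the sup norm; then [h'' = k + f_x h]
    bounds the second derivative. *)
Lemma dTop_inj x : inX x -> exists2 C, 0 < C & forall h, inX h ->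
  Xnorm h <= C * L2norm (dTop x h).
Proof.
move=> hx; have [C C0 EB] := energy_bound c0 cpi.
have [K K0 HK] := mul_fx_norm (inX_cont hx).
exists (1 + K * C); first by rewrite addr_gt0// mulr_gt0.
move=> h hh; have Lk := dTop_L2 hx hh; have Dh := inX_D2 hh.
have hb t : 0 <= t <= 1 -> `|h t| <= C * L2norm (dTop x h).
  apply: (EB _ _ _ Dh Lk) => {}t tI; rewrite /dTop opprB addrC subrK.
  by apply: ge0_mul_of_lower; exact: fx_ge.
have Lq := mul_fx_L2 (inX_cont hx) (inX_cont hh).
rewrite /Xnorm [ddot h](_ : ddot h = fadd (dTop x h) (fun t => fx t (x t) * h t)); last first.
  by apply/funext => t; rewrite /fadd /dTop subrK.
apply: le_trans (L2normD Lk Lq) _; rewrite mulrDl mul1r lerD2l -mulrA.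
by apply: HK => //; exact: inX_cont.
Qed.

Lemma Top_diffeomorphism :
  diffeomorphism (@inX R) (@Xnorm R) (@L2 R) (@L2norm R) (Top f).
Proof.
have [C C0 EB] := energy_bound c0 cpi.
split.
  split; first exact: Top_L2.
  by exists dTop; split; [exact: Top_deriv|exact: dTop_cont].
have /choice[G HG] : forall y, exists x, L2 y -> D2 x (fadd y (fun t => f t (x t))).
  move=> y; have [Ly|nLy] := pselect (L2 y); last by exists y.
  by have [x hx] := solution_exists f_cont f_deriv fx_cont c0 cpi fx_ge Ly; exists x.
have GX y : L2 y -> inX (G y) by move=> /HG/D2_inX.
have /choice[DG HDG] : forall p : (R -> R) * (R -> R), exists h, L2 p.1 -> L2 p.2 ->
    D2 h (fadd p.2 (fun t => fx t (G p.1 t) * h t)).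
  move=> [y k]; have [[Ly Lk]|nL] := pselect (L2 y /\ L2 k); last first.
    by exists y => Ly Lk; case: nL.
  have [h hh] := linear_exists fx_cont c0 cpi fx_ge (inX_cont (GX _ Ly)) Lk.
  by exists h.
exists G; split; [|split].
- apply: (@inverse_C1 R _ _ _ _ (seminormed_inX R) (seminormed_L2 R) (Top f) G dTop
    (fun y k => DG (y, k))) => //.
  + exact: Top_L2.
  + exact: Top_deriv.
  + exact: dTop_cont.
  + move=> y Ly; apply: ae01_L2norm_sub => //; first exact: Top_L2 (GX _ Ly).
    apply: filterS (D2_ddot (HG _ Ly)) => t e /e; rewrite /Top => ->.
    by rewrite /fadd addrK.
  + by move=> y k Ly Lk; exact: D2_inX (HDG (y, k) Ly Lk).
  + move=> y k Ly Lk; have hh := HDG (y, k) Ly Lk.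
    apply: ae01_L2norm_sub => //; first exact: dTop_L2 (GX _ Ly) (D2_inX hh).
    apply: filterS (D2_ddot hh) => t e /e; rewrite /dTop => ->.
    by rewrite /fadd addrK.
  + exact: dTop_inj.
  + move=> y Ly; have hx := HG _ Ly; set x := G y in hx *.
    have [M M0 HM] := cont01_bounded (D2_cont hx).
    (* [f] is Lipschitz in its second variable on bounded sets only. For [|k| < 1] the two solutions
       differ by at most [C], so both take values in [[- (M + C), M + C]]; hence the radius 1
       below. *)
    have [L L0 HL] := f_lipschitz f_deriv fx_cont (M + C).
    exists (1 + L * C); first by rewrite addr_gt0// mulr_gt0.
    exists 1 => // k Lk k1; have hx' := HG _ (L2D Ly Lk); set x' := G (fadd y k) in hx' *.
    have hd := D2B hx' hx; set w := fsub (fadd (fadd y k) _) _ in hd.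
    pose r t := f t (x' t) - f t (x t).
    have Lr : L2 r by apply: L2B; apply: f_L2; [exact: D2_cont hx'|exact: D2_cont hx].
    have wE : w = fadd k r by apply/funext => t; rewrite /w /r /fadd /fsub; ring.
    have db t : 0 <= t <= 1 -> `|fsub x' x t| <= C * L2norm k.
      apply: (EB _ _ _ hd Lk) => {}t tI; rewrite wE /fadd [_ + r t]addrC addrK.
      exact: f_monotone.
    rewrite (D2_Xnorm hd) wE; apply: le_trans (L2normD Lk Lr) _.
    rewrite mulrDl mul1r lerD2l; apply: L2norm_sup; first exact: L2_meas.
    move=> t tI; have xM := HM t tI; have xd := db t tI.
    have dC : C * L2norm k <= C by rewrite ler_piMr// ltW.
    apply: le_trans (HL _ _ _ tI _ _) _; last by rewrite -mulrA ler_wpM2l// ltW.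
      have -> : x' t = x t + fsub x' x t by rewrite /fsub subrKC.
      by rewrite (le_trans (ler_normD _ _))// lerD// (le_trans xd).
    by rewrite (le_trans xM)// lerDl ltW.
(* Uniqueness: two solutions with the same right-hand side differ by a function to which [EB]
   applies with [k = 0]. *)
- move=> x hx; have LF := Top_L2 hx; have hd := D2B (HG _ LF) (inX_D2 hx).
  apply: (D2_eq0 hd) => t tI; apply/eqP; rewrite -normr_le0.
  rewrite -(mulr0 C) -(L2norm0 R).
  apply: (EB _ _ _ hd (L2_cst 0)) tI => {}t tI.
  have := f_monotone f_deriv fx_ge (G (Top f x) t) (x t) tI; congr (_ <= _ * _).
  by rewrite /fsub /fadd /Top; ring.
- move=> y Ly; apply: ae01_L2norm_sub => //; first exact: Top_L2 (GX _ Ly).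
  apply: filterS (D2_ddot (HG _ Ly)) => t e /e; rewrite /Top => ->.
  by rewrite /fadd addrK.
Qed.

End TopDiffeomorphism.

Theorem theorem4 (R : realType) (f : R -> R -> R) (fx : R -> R -> R) :
  (* C(c) *)
  {within [set p : R * R | 0 <= p.1 <= 1], continuous (fun p : R * R => f p.1 p.2)} ->
  (forall t x : R, 0 <= t <= 1 -> is_derive x 1 (f t) (fx t x)) ->
  {within [set p : R * R | 0 <= p.1 <= 1], continuous (fun p : R * R => fx p.1 p.2)} ->
  (* C(f) *)
  (exists A B : R, 0 < A /\ 0 < B /\ A < pi ^+ 2 /\
     forall t x : R, 0 <= t <= 1 -> `|f t x| <= A * `|x| + B) ->
  (* C(f_x) : inf of f_x over [0,1] x R is > -pi^2 *)
  (exists m : R, - pi ^+ 2 < m /\ forall t x : R, 0 <= t <= 1 -> m <= fx t x) ->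
  diffeomorphism (@inX R) (@Xnorm R) (@L2 R) (@L2norm R) (Top f).
Proof.
move=> cf df cfx _ [m [mpi fxm]].
have pi20 : (0 : R) < pi ^+ 2 by rewrite exprn_gt0// pi_gt0.
(* The energy estimate asks for [c >= 0], while [m] may be positive; hence the maximum with 0. *)
apply: (@Top_diffeomorphism R f fx cf df cfx (Num.max 0 (- m))).
- by rewrite le_max lexx.
- by rewrite gt_max pi20 /= ltrNl.
- by move=> t x tI; rewrite lerNl le_max lerN2 fxm ?orbT.
Qed.
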